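(* Let $r \in \{3,4,5\}$ and let $p = p(n) \in [0,1]$ be any function of $n$. Then, with high probability, $$\tau^{(r-1)}\left(H_r(n,p)\right) \leq \left\lceil \frac{r+1}{2} \right\rceil \, \nu^{(r-1)}\left(H_r(n,p)\right).$$
   Context: An $r$-graph $G$ is a set of $r$-element subsets (edges) of a vertex set $V(G)$. An $(r-1)$-matching in $G$ is a set of edges of $G$ any two distinct members of which intersect in fewer than $r-1$ vertices; $\nu^{(r-1)}(G)$ is the maximum size of an $(r-1)$-matching in $G$. An $(r-1)$-cover of $G$ is a collection of $(r-1)$-element subsets of $V(G)$ such that every edge of $G$ contains at least one member of the collection; $\tau^{(r-1)}(G)$ is the minimum size of an $(r-1)$-cover of $G$. $H_r(n,p)$ denotes the random $r$-graph on a set $V$ of $n$ labelled vertices in which each $r$-element subset of $V$ is an edge with probability $p$, independently of the others. ''With high probability'' means with probability tending to $1$ as $n \to \infty$. *)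

(* Defs.v *)
From mathcomp Require Import all_boot all_order all_algebra.
From mathcomp Require Import reals.

Set Implicit Arguments.
Unset Strict Implicit.
Unset Printing Implicit Defensive.

Import GRing.Theory.

Local Open Scope ring_scope.

Section Hypergraphs.
Variable V : finType.
Implicit Types (r k : nat) (G M C : {set {set V}}).

Definition ksets k : {set {set V}} := [set S : {set V} | #|S| == k].

Definition is_rgraph r G : bool := G \subset ksets r.

Definition is_matching k G M : bool :=
  (M \subset G) &&
  [forall e in M, forall f in M, (e != f) ==> (#|e :&: f| < k)%N].

Definition is_cover k G C : bool :=
  (C \subset ksets k) && [forall e in G, exists S in C, S \subset e].

Definition nu k G : nat := \max_(M | is_matching k G M) #|M|.

(* [ksets k] is a cover as soon as every edge has at least k vertices; without
   any cover the value of [tau] would be meaningless. *)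
Definition tau k G : nat := #|[arg min_(C < ksets k | is_cover k G C) #|C|]|.

Lemma ksets_cover r k G : (k <= r)%N -> is_rgraph r G -> is_cover k G (ksets k).
Proof.
move=> le_kr /subsetP rG; apply/andP; split=> //.
apply/forall_inP => e /rG; rewrite inE => /eqP er.
have /set0Pn[S] : [set S : {set V} | S \subset e & (#|S| == k)] != set0.
  by rewrite -card_gt0 cards_draws er bin_gt0.
by rewrite inE => /andP[Se Sk]; apply/exists_inP; exists S; rewrite ?inE.
Qed.

Lemma tauP r k G : (k <= r)%N -> is_rgraph r G ->
  (exists2 C, is_cover k G C & #|C| = tau k G) /\
  (forall C, is_cover k G C -> (tau k G <= #|C|)%N).
Proof.
move=> le_kr rG; rewrite /tau; case: arg_minnP => [|C0 C0cov C0min].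
  exact: ksets_cover le_kr rG.
by split; first by exists C0.
Qed.

Lemma nuP k G :
  (exists2 M, is_matching k G M & #|M| = nu k G) /\
  (forall M, is_matching k G M -> (#|M| <= nu k G)%N).
Proof.
split=> [|M Mm]; last exact: (@leq_bigmax_cond _ _ (fun A : {set {set V}} => #|A|)).
have m0 : is_matching k G set0.
  by rewrite /is_matching sub0set; apply/forall_inP => e; rewrite inE.
have [|M Mm eqM] := @eq_bigmax_cond _ (is_matching k G) (fun A => #|A|).
  by apply/card_gt0P; exists set0.
by exists M.
Qed.

End Hypergraphs.

(* The random r-graph H_r(n, p) has vertex set 'I_n; the independent choices of
   the edges give the product over all r-subsets. *)
Definition rgraph_pmf (R : realType) (r n : nat) (p : R)
    (G : {set {set 'I_n}}) : R :=
  \prod_(e in ksets 'I_n r) (if e \in G then p else 1 - p).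

Definition rgraph_prob (R : realType) (r n : nat) (p : R)
    (E : pred {set {set 'I_n}}) : R :=
  \sum_(G : {set {set 'I_n}} | is_rgraph r G && E G) rgraph_pmf r p G.

Lemma rgraph_prob_total (R : realType) (r n : nat) (p : R) :
  rgraph_prob r p (@predT {set {set 'I_n}}) = 1.
Proof.
pose K := ksets 'I_n r.
have : \prod_e ((if e \in K then p else 0) + (if e \in K then 1 - p else 1)) = 1.
  by apply: big1 => e _; case: ifP; rewrite ?add0r // addrC subrK.
rewrite bigA_distr /= (bigID (fun G : {set {set 'I_n}} => G \subset K)) /= [X in _ + X]big1 ?addr0.
  move=> <-; apply: eq_big => [G|G]; rewrite andbT // => /subsetP rG.
  rewrite /rgraph_pmf big_mkcond; apply: eq_bigr => e _.
  by rewrite -/K; case: (boolP (e \in K)) => // /(contra (rG e)) /negbTE ->.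
by move=> G /subsetPn[e eG eK]; rewrite (bigD1 e) //= eG (negbTE eK) mul0r.
Qed.

(* Main.v *)
Require Import Defs.
From mathcomp Require Import classical_sets reals topology normedtype sequences exp.
From mathcomp Require Import all_boot all_order all_algebra ring lra zify.
Import numFieldNormedType.Exports.

Set Implicit Arguments.
Unset Strict Implicit.
Unset Printing Implicit Defensive.

Import Order.TTheory GRing.Theory Num.Theory.
Local Open Scope ring_scope.

(** Put k = r - 1, let N be the number of k-sets of vertices, and let c = n p,
    which is nearly the mean number of edges through a k-set.  Call the k-sets
    points and the r-sets lines; a line contains r points and two lines share
    at most one.  Then nu is the largest number of pairwise disjoint lines in
    the random set of lines, and tau the least number of points meeting them
    all.  With m the constant of the statement, the aim is m nu >= tau.

    Adding an edge changes nu and tau by at most one, so by [Efron_Stein] the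
    variance of m nu - tau is at most a constant times the expected number of
    edges.  By [Chebyshev] it is enough that the mean of m nu - tau is at least
    a fixed fraction of that number ([gap]), provided that number is large.
    When it is bounded, typically no two edges share a point, and then
    tau <= nu ([slack_sparse]).

    For nu, take a greedy matching.  Label a line by the sum of its vertices
    modulo n: lines with one label are disjoint, and through a point there is
    one line with each label, up to k exceptions.  Process the labels in order.
    Whether a point is still free at time t is found by inspecting the lines
    through it with smaller labels and, recursively, the points of those that
    are edges.  As the labels decrease along such an exploration, its expected
    size stays O(n) for bounded c ([query_prob_total]), and the explorations
    from the r points of a line hardly meet: the r points are free almost
    independently ([decoupling], [all_free_prob_prod]).  Hence the probability u
    that a point is free satisfies u(t+1) = u(t) - p u(t) ^ r up to O(p), which
    gives u(n) ^ k (1 + k c) <= 1 and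
    r E nu >= N (1 - (1 + k c) ^ (-1/k) - O(p))  ([nu_lower]).

    For tau, let D be a family of kap N points that meets every line.  Assign
    each line to a point of D on it and keep the points that received an edge:
    by concavity E tau <= kap N (1 - exp (- c / (r kap))) nearly
    ([tau_alloc]).  This suffices for r = 4 and r = 5, with kap = 4/9 by Turan's
    construction and kap = 5/16 by Giraud's.  For r = 3 and kap = 1/2 it falls
    short near c = 3.  There D consists of the pairs inside two halves of the
    vertex set; first keep the pairs forced by an edge with its third vertex in
    the other half, and then one pair for each edge that is still not covered.
    With y = exp (- c / 2) this costs at most N ((1 - y) / 2 + c y ^ 3 / 12)
    nearly ([tau_halves]).

    It remains to compare functions of c.  For small c, tau is at most the
    number of edges ([gap_small]).  For c in a bounded range both bounds are
    monotone enough for a finite grid of values c = (s ^ k - 1) / k, where the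
    bound for nu is N (1 - 1 / s) / r ([gap_step]).  For larger c, E nu only
    grows with p while tau <= kap N ([gap_dense]). *)

(** * Expectation over a random subset *)

Lemma bernoulli_ge (R : realFieldType) (z : R) k : -1 <= z -> 1 + k%:R * z <= (1 + z) ^+ k.
Proof.
move=> z1; elim: k => [|k IHk]; first by rewrite mul0r expr0 addr0.
rewrite exprS -natr1; apply: (@le_trans _ _ ((1 + z) * (1 + k%:R * z))).
  have : 0 <= k%:R * (z ^+ 2) by rewrite mulr_ge0 ?sqr_ge0.
  by rewrite expr2; lra.
by rewrite ler_wpM2l ?IHk //; lra.
Qed.

Section RandomSubset.
Variables (R : realFieldType) (T : finType).
Implicit Types (p : R) (K G : {set T}) (f g h : {set T} -> R).

Definition weight p K G : R := \prod_(e in K) (if e \in G then p else 1 - p).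

Definition Ex p K f : R := \sum_(G : {set T} | G \subset K) weight p K G * f G.

Lemma weight_ge0 p K G : 0 <= p <= 1 -> 0 <= weight p K G.
Proof.
by move=> /andP[p0 p1]; apply: prodr_ge0 => e _; case: ifP => // _; rewrite subr_ge0.
Qed.

Lemma eq_Ex p K f g : (forall G, G \subset K -> f G = g G) -> Ex p K f = Ex p K g.
Proof. by move=> fg; apply: eq_bigr => G /fg ->. Qed.

Lemma Ex0 p f : Ex p set0 f = f set0.
Proof.
rewrite /Ex (big_pred1 set0) => [|G]; last by rewrite subset0.
by rewrite /weight big_set0 mul1r.
Qed.

(** Induction on [K] through this splitting gives independence, monotonicity in [p]
    and the variance bound. *)
Lemma Ex_split p K f e : e \in K ->
  Ex p K f = p * Ex p (K :\ e) (fun G => f (e |: G)) + (1 - p) * Ex p (K :\ e) f.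
Proof.
move=> eK; rewrite /Ex (bigID (fun G : {set T} => e \in G)) /=; congr (_ + _).
  rewrite big_distrr /=.
  rewrite (reindex_onto (fun G => e |: G) (fun G => G :\ e)) /=; last first.
    by move=> G /andP[_ eG]; rewrite setD1K.
  apply: eq_big => [G|G /andP[/andP[sGK _] /eqP defG]].
    rewrite setU11 andbT subUset sub1set eK /= subsetD1.
    apply/andP/andP => [[GK /eqP eG]|[GK eG]]; split=> //.
      by rewrite -eG setD11.
    by rewrite setU1K.
  rewrite mulrA; congr (_ * _).
  rewrite /weight (bigD1 e) //= setU11; congr (_ * _).
  apply: eq_big => [x|x]; first by rewrite in_setD1 andbC.
  by move=> /andP[_ /negbTE xe]; rewrite in_setU1 xe.
rewrite big_distrr /=; apply: eq_big => [G|G /andP[_ eG]].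
  by rewrite subsetD1.
rewrite mulrA; congr (_ * _).
rewrite /weight (bigD1 e) //= (negbTE eG); congr (_ * _).
by apply: eq_bigl => x; rewrite in_setD1 andbC.
Qed.

Lemma set_ind_D1 (Q : {set T} -> Prop) :
  Q set0 -> (forall K e, e \in K -> Q (K :\ e) -> Q K) -> forall K, Q K.
Proof.
move=> Q0 QS K; have [k] := ubnP #|K|; elim: k K => // k IHk K.
have [->//|[e eK]] := set_0Vmem K.
by rewrite (cardsD1 e) eK ltnS => Kk; apply: (QS _ e) => //; apply: IHk.
Qed.

Lemma notin_setD1 G e : e \notin G -> G :\ e = G.
Proof.
by move=> eG; apply/setP => x; rewrite in_setD1; case: eqP => // ->; rewrite (negbTE eG).
Qed.

Lemma Ex_cst p K (a : R) : Ex p K (fun=> a) = a.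
Proof.
elim/set_ind_D1: K => [|K e eK IH]; first by rewrite Ex0.
by rewrite (Ex_split _ _ eK) IH; ring.
Qed.

Lemma Ex_eq_cst p K f a : (forall G, G \subset K -> f G = a) -> Ex p K f = a.
Proof. by move=> fa; rewrite -[RHS](Ex_cst p K); exact: eq_Ex. Qed.

Lemma ExD p K f g : Ex p K (fun G => f G + g G) = Ex p K f + Ex p K g.
Proof. by rewrite /Ex -big_split /=; apply: eq_bigr => G _; rewrite mulrDr. Qed.

Lemma ExZ p K a f : Ex p K (fun G => a * f G) = a * Ex p K f.
Proof. by rewrite /Ex big_distrr /=; apply: eq_bigr => G _; rewrite mulrCA. Qed.

Lemma ExB p K f g : Ex p K (fun G => f G - g G) = Ex p K f - Ex p K g.
Proof.
rewrite -mulN1r -ExZ -ExD; apply: eq_Ex => G _; ring.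
Qed.

Lemma Ex_sum p K (I : finType) (A : pred I) (F : I -> {set T} -> R) :
  Ex p K (fun G => \sum_(i | A i) F i G) = \sum_(i | A i) Ex p K (F i).
Proof.
rewrite /Ex exchange_big /=; apply: eq_bigr => G _; exact: big_distrr.
Qed.

Lemma ler_Ex p K f g : 0 <= p <= 1 ->
  (forall G, G \subset K -> f G <= g G) -> Ex p K f <= Ex p K g.
Proof.
move=> p01 fg; apply: ler_sum => G GK; apply: ler_wpM2l; last exact: fg.
exact: weight_ge0.
Qed.

Lemma Ex_ge0 p K f : 0 <= p <= 1 ->
  (forall G, G \subset K -> 0 <= f G) -> 0 <= Ex p K f.
Proof. by move=> p01 /(ler_Ex p01); rewrite Ex_cst. Qed.

Lemma ler_norm_Ex p K f : 0 <= p <= 1 -> `|Ex p K f| <= Ex p K (fun G => `|f G|).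
Proof.
move=> p01; rewrite ler_norml -mulN1r -ExZ; apply/andP; split; apply: ler_Ex => // G _.
  by rewrite mulN1r lerNl ler_normr lexx orbT.
by rewrite ler_norm.
Qed.

Lemma Ex_mem p K f e : e \in K -> (forall G, f (e |: G) = f (G :\ e)) ->
  Ex p K (fun G => (e \in G)%:R * f G) = p * Ex p K f.
Proof.
move=> eK fe; rewrite (Ex_split _ _ eK) [Ex p K f](Ex_split _ _ eK).
have -> : Ex p (K :\ e) (fun G => f (e |: G)) = Ex p (K :\ e) f.
  by apply: eq_Ex => G; rewrite subsetD1 => /andP[_ eG]; rewrite fe (notin_setD1 eG).
rewrite [X in p * X + _](_ : _ = Ex p (K :\ e) f); last first.
  apply: eq_Ex => G; rewrite subsetD1 => /andP[_ eG].
  by rewrite setU11 mul1r fe (notin_setD1 eG).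
rewrite [X in _ + _ * X](_ : _ = 0) => [|]; first by ring.
rewrite -[RHS](Ex_cst p (K :\ e)); apply: eq_Ex => G.
by rewrite subsetD1 => /andP[_ /negbTE ->]; rewrite mul0r.
Qed.

Lemma Ex_notin p K f e : e \in K -> (forall G, f (e |: G) = f (G :\ e)) ->
  Ex p K (fun G => (e \notin G)%:R * f G) = (1 - p) * Ex p K f.
Proof.
move=> eK fe; rewrite mulrBl mul1r -(Ex_mem _ eK fe) -ExB.
by apply: eq_Ex => G _; case: (e \in G) => /=; ring.
Qed.

Lemma Ex_disjoint p K (B : {set T}) : B \subset K ->
  Ex p K (fun G => [disjoint B & G]%:R) = (1 - p) ^+ #|B|.
Proof.
elim/set_ind_D1: B => [_|B e eB IH sBK].
  rewrite cards0 expr0 -[RHS](Ex_cst p K); apply: eq_Ex => G _.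
  by rewrite disjoints_subset sub0set.
rewrite (cardsD1 e) eB /= exprS -IH; last by apply: subset_trans sBK; exact: subD1set.
rewrite -(@Ex_notin _ _ _ e) => [|//|G]; last first.
- rewrite !disjoints_subset; congr (nat_of_bool _)%:R; apply/subsetP/subsetP => H x xB;
    have := H x xB; move: xB; rewrite !inE => /andP[/negbTE -> _] //=.
- exact: (subsetP sBK).
apply: eq_Ex => G _; rewrite -natrM mulnb -{1}(setD1K eB); congr (nat_of_bool _)%:R.
by rewrite !disjoints_subset subUset sub1set in_setC.
Qed.

Lemma Ex_monotone p q K f : 0 <= p -> p <= q -> q <= 1 ->
  (forall e G, e \in K -> G \subset K -> f G <= f (e |: G)) -> Ex p K f <= Ex q K f.
Proof.
move=> p0 pq q1; elim/set_ind_D1: K f => [|K e eK IH] f fm; first by rewrite !Ex0.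
rewrite !(Ex_split _ _ eK).
have sK : K :\ e \subset K by apply: subD1set.
have I1 := IH (fun G => f (e |: G)).
have I0 := IH f.
have {}I1 : Ex p (K :\ e) (fun G => f (e |: G)) <= Ex q (K :\ e) (fun G => f (e |: G)).
  apply: I1 => x G xK GK; rewrite setUCA; apply: fm; first exact: (subsetP sK).
  by rewrite subUset sub1set eK (subset_trans GK).
have {}I0 : Ex p (K :\ e) f <= Ex q (K :\ e) f.
  by apply: I0 => x G xK GK; apply: fm; [exact: (subsetP sK)|exact: subset_trans GK _].
have J : Ex q (K :\ e) f <= Ex q (K :\ e) (fun G => f (e |: G)).
  apply: ler_Ex => [|G GK]; first by rewrite q1 (le_trans p0).
  by apply: fm => //; exact: subset_trans GK _.
by nra.
Qed.

Definition Var p K f : R := Ex p K (fun G => f G ^+ 2) - Ex p K f ^+ 2.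

(** Splitting off one coordinate, the variance is the mean of the two conditional
    variances plus [p * (1 - p)] times the square of the difference of the two
    conditional means, which is at most [l]. *)
Lemma Efron_Stein p K f (l : R) : 0 <= p <= 1 ->
  (forall e G, e \in K -> G \subset K -> `|f (e |: G) - f G| <= l) ->
  Var p K f <= l ^+ 2 * (p * #|K|%:R).
Proof.
move=> p01; elim/set_ind_D1: K f => [|K e eK IH] f fl.
  by rewrite /Var !Ex0 cards0 subrr !mulr0.
have sK : K :\ e \subset K by apply: subD1set.
have I1 : Var p (K :\ e) (fun G => f (e |: G)) <= l ^+ 2 * (p * #|K :\ e|%:R).
  apply: IH => x G xK GK; rewrite setUCA; apply: fl; first exact: (subsetP sK).
  by rewrite subUset sub1set eK (subset_trans GK).
have I0 : Var p (K :\ e) f <= l ^+ 2 * (p * #|K :\ e|%:R).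
  by apply: IH => x G xK GK; apply: fl; [exact: (subsetP sK)|exact: subset_trans GK _].
have J : `|Ex p (K :\ e) (fun G => f (e |: G)) - Ex p (K :\ e) f| <= l.
  rewrite -ExB (le_trans (ler_norm_Ex _ _ _)) // -[leRHS](Ex_cst p (K :\ e)).
  by apply: ler_Ex => // G GK; apply: fl => //; exact: subset_trans GK _.
have {}J : (Ex p (K :\ e) (fun G => f (e |: G)) - Ex p (K :\ e) f) ^+ 2 <= l ^+ 2.
  move: J; set x := _ - _; rewrite ler_norml => /andP[x1 x2].
  by rewrite -subr_ge0 subr_sqr; apply: mulr_ge0; lra.
move: I1 I0; rewrite (cardsD1 e K) eK /= natrD /Var !(Ex_split _ _ eK).
set a := Ex _ _ _; set b := Ex _ _ _; set a2 := Ex _ _ _; set b2 := Ex _ _ _.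
set k : R := _%:R; set l2 := l ^+ 2 in J *; move=> I1 I0.
have l0 : 0 <= l2 by apply: sqr_ge0.
have H1 : p * (a - b ^+ 2) + (1 - p) * (a2 - b2 ^+ 2) <= l2 * (p * k) by nra.
have H2 : p * (1 - p) * (b - b2) ^+ 2 <= p * l2.
  move: J; set x := (b - b2) ^+ 2 => J; have x0 : 0 <= x by apply: sqr_ge0.
  have [p0 p1] := andP p01; rewrite -mulrA ler_wpM2l // (le_trans _ J) //.
  by rewrite ler_piMl //; lra.
suff -> : p * a + (1 - p) * a2 - (p * b + (1 - p) * b2) ^+ 2 =
  p * (a - b ^+ 2) + (1 - p) * (a2 - b2 ^+ 2) + p * (1 - p) * (b - b2) ^+ 2 by lra.
by ring.
Qed.

Lemma Chebyshev p K f (l : R) : 0 <= p <= 1 -> 0 < Ex p K f ->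
  (forall e G, e \in K -> G \subset K -> `|f (e |: G) - f G| <= l) ->
  Ex p K (fun G => (f G < 0)%R%:R) <= l ^+ 2 * (p * #|K|%:R) / Ex p K f ^+ 2.
Proof.
move=> p01 m0 /(Efron_Stein p01) V; set m := Ex p K f in m0 V *.
rewrite ler_pdivlMr ?exprn_gt0 // (le_trans _ V) // mulrC -ExZ.
have -> : Var p K f = Ex p K (fun G => (f G - m) ^+ 2).
  transitivity (Ex p K (fun G => f G ^+ 2 + (- (2 * m) * f G + m ^+ 2))); last first.
    by apply: eq_Ex => G _; ring.
  by rewrite !ExD ExZ Ex_cst /Var -/m; ring.
apply: ler_Ex => // G _; case: ltP => h; last by rewrite mulr0 sqr_ge0.
by rewrite mulr1; nra.
Qed.

End RandomSubset.

(** * Decoupling two explorations of a random set *)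

Section Decoupling.
Variables (R : realFieldType) (T : finType).
Implicit Types (p : R) (K G : {set T}).

(** [Q G] is the set of elements read by an exploration of [G]: rerunning the
    exploration on a set that agrees with [G] there reads the same elements. *)
Definition stopping (Q : {set T} -> {set T}) :=
  forall G G', {in Q G, G =i G'} -> Q G' = Q G.

Definition splice (Q A B : {set T}) : {set T} := (A :&: Q) :|: (B :\: Q).

Lemma in_splice Q A B x : (x \in splice Q A B) = (if x \in Q then x \in A else x \in B).
Proof. by rewrite !inE; case: (x \in Q); rewrite /= ?andbT ?andbF ?orbF. Qed.

(** Exchanging two independent copies outside the part read in the first one is
    an involution that preserves the product measure. *)
Lemma Ex_swap p K (Q : {set T} -> {set T}) (F : {set T} -> {set T} -> R) :
  stopping Q ->
  Ex p K (fun G => Ex p K (F G)) =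
  Ex p K (fun G => Ex p K (fun G' => F (splice (Q G) G G') (splice (Q G) G' G))).
Proof.
move=> stopQ.
pose s (X : {set T} * {set T}) := (splice (Q X.1) X.1 X.2, splice (Q X.1) X.2 X.1).
have Qs X : Q (s X).1 = Q X.1.
  by apply: stopQ => x xQ /=; rewrite in_splice xQ.
have sK : involutive s.
  move=> X; rewrite {1}/s Qs /s; case: X => A B /=; congr (_, _); apply/setP => x;
    by rewrite !in_splice; case: (x \in _).
have ExE H : Ex p K (fun G => Ex p K (H G)) =
    \sum_(X : {set T} * {set T} | (X.1 \subset K) && (X.2 \subset K))
      weight p K X.1 * weight p K X.2 * H X.1 X.2.
  rewrite -(pair_big (fun A : {set T} => A \subset K) (fun A : {set T} => A \subset K)
    (fun A B => weight p K A * weight p K B * H A B)) /=.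
  apply: eq_bigr => A _; rewrite /Ex big_distrr /=.
  by apply: eq_bigr => B _; rewrite mulrA.
have sub_splice (X : {set T} * {set T}) : (X.1 \subset K) && (X.2 \subset K) ->
    ((s X).1 \subset K) && ((s X).2 \subset K).
  case: X => A B /= /andP[/subsetP AK /subsetP BK].
  by apply/andP; split; apply/subsetP => x; rewrite in_splice; case: ifP => _; auto.
rewrite !ExE (reindex_inj (inv_inj sK)) /=; apply: eq_big => [X|X _].
  apply/idP/idP; last exact: sub_splice.
  by move=> /(sub_splice (s X)); rewrite sK.
congr (_ * _); rewrite /weight -!big_split /=; apply: eq_bigr => e _.
by rewrite !in_splice; case: (e \in Q X.1) => //; rewrite mulrC.
Qed.

(** Run two explorations, the second one first on the same random set and then
    on a fresh copy outside the part read by the first.  The outcomes can only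
    differ through an element read by both and present in one of the copies,
    and in the fresh copy the two readings are independent: this is why a
    product of two probabilities appears on the right. *)
Lemma decoupling p K (Qg Qh : {set T} -> {set T}) (g h : {set T} -> bool) :
  0 <= p <= 1 ->
  stopping Qh -> (forall G G', {in Qh G, G =i G'} -> h G' = h G) ->
  (forall G G', {in Qg G, G =i G'} -> g G' = g G) ->
  (forall G, Qg G \subset K) ->
  (forall f G, (f \in Qg (f |: G)) = (f \in Qg (G :\ f))) ->
  (forall f G, (f \in Qh (f |: G)) = (f \in Qh (G :\ f))) ->
  `|Ex p K (fun G => (g G && h G)%:R) - Ex p K (fun G => (g G)%:R) * Ex p K (fun G => (h G)%:R)|
  <= 2 * p * \sum_(f in K) Ex p K (fun G => (f \in Qg G)%:R) * Ex p K (fun G => (f \in Qh G)%:R).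
Proof.
move=> p01 stopQh hQh gQg QgK Qgf Qhf.
have E1 : Ex p K (fun G => (g G && h G)%:R) =
    Ex p K (fun G => Ex p K (fun G' => (g (splice (Qh G) G G'))%:R * (h G)%:R)).
  transitivity (Ex p K (fun G => Ex p K (fun _ : {set T} => (g G && h G)%:R : R))).
    by apply: eq_Ex => G _; rewrite Ex_cst.
  rewrite (Ex_swap p K _ stopQh); apply: eq_Ex => G _; apply: eq_Ex => G' _.
  rewrite -natrM mulnb; congr (nat_of_bool (_ && _))%:R.
  by apply: hQh => x xQ; rewrite in_splice xQ.
have E2 : Ex p K (fun G => (g G)%:R) * Ex p K (fun G => (h G)%:R) =
    Ex p K (fun G => Ex p K (fun G' => (g G')%:R * (h G)%:R)).
  rewrite -ExZ; apply: eq_Ex => G _; rewrite mulrC -ExZ.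
  by apply: eq_Ex => G' _; rewrite mulrC.
rewrite {}E1 {}E2 -ExB.
apply: (le_trans (ler_norm_Ex _ _ p01)).
pose a f G : R := (f \in Qg G)%:R; pose b f G : R := (f \in Qh G)%:R.
pose i f G : R := (f \in G)%:R.
have key G G' : `|(g (splice (Qh G) G G'))%:R * (h G)%:R - (g G')%:R * (h G)%:R| <=
    \sum_(f in K) (b f G * i f G * a f G' + b f G * (i f G' * a f G')) :> R.
  rewrite -mulrBl normrM; set d := `|_ - _|; apply: (@le_trans _ _ d).
    by rewrite ler_piMr ?normr_ge0 // normr_nat lern1 leq_b1.
  rewrite {}/d.
  have s0 f : 0 <= b f G * i f G * a f G' + b f G * (i f G' * a f G').
    by rewrite addr_ge0 ?mulr_ge0.
  have [/existsP[f /and4P[fK fh fg fx]]|/existsPn none] :=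
    boolP [exists f, [&& f \in K, f \in Qh G, f \in Qg G' & (f \in G) || (f \in G')]].
    rewrite (bigD1 f) //= (@le_trans _ _ 1) //; last first.
      rewrite ler_wpDr ?sumr_ge0 // /a /b /i fh fg !mul1r !mulr1.
      by case: (f \in G) fx => /= [_|->]; rewrite ?lerDl ?add0r.
    by case: (g _); case: (g _); rewrite ?subrr ?subr0 ?sub0r ?normrN ?normr0 ?normr1.
  rewrite (_ : g (splice (Qh G) G G') = g G') ?subrr ?normr0 ?sumr_ge0 //.
  apply: gQg => f fg; rewrite in_splice; case: ifP => // fh.
  have := none f; rewrite fh fg (subsetP (QgK _) _ fg) /= negb_or.
  by case/andP => /negbTE -> /negbTE ->.
apply: (@le_trans _ _ (Ex p K (fun G => Ex p K (fun G' =>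
   \sum_(f in K) (b f G * i f G * a f G' + b f G * (i f G' * a f G')))))).
  apply: ler_Ex => // G _; rewrite -ExB; apply: (le_trans (ler_norm_Ex _ _ p01)).
  by apply: ler_Ex => // G' _; exact: key.
rewrite le_eqVlt; apply/orP; left; apply/eqP.
transitivity (Ex p K (fun G => \sum_(f in K)
   (b f G * i f G * Ex p K (a f) + b f G * (p * Ex p K (a f))))).
  apply: eq_Ex => G _; rewrite Ex_sum; apply: eq_bigr => f fK.
  rewrite ExD !ExZ; congr (_ + _ * _).
  by apply: Ex_mem => // G'; rewrite /a Qgf.
rewrite Ex_sum big_distrr /=; apply: eq_bigr => f fK.
transitivity (Ex p K (fun G => Ex p K (a f) * (i f G * b f G) + (p * Ex p K (a f)) * b f G)).
  by apply: eq_Ex => G _; ring.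
rewrite ExD !ExZ (Ex_mem _ fK) => [|G']; last by rewrite /b Qhf.
by rewrite /a /b; ring.
Qed.

End Decoupling.

(** * The greedy matching in a linear hypergraph *)

Lemma sum_nat_in (T : finType) (A : {set T}) (b : pred T) :
  (\sum_(x in A) b x = #|[set x in A | b x]|)%N.
Proof.
rewrite -sum1_card [RHS](eq_bigl (fun x => (x \in A) && b x)) => [|x]; last by rewrite inE.
by rewrite big_mkcondr.
Qed.

Section Greedy.
Variables (P L : finType) (K : {set L}) (pts : L -> {set P}) (lab : L -> nat).
Implicit Types (G : {set L}) (S : P) (f g : L).

(** A hypergraph with vertex set [P] and edge set [K]; the elements of [P] are
    called points, those of [K] lines, and [lab] gives the time at which a line
    is offered to the greedy matching. *)
Definition lines_at t S : {set L} := [set f in K | (S \in pts f) && (lab f == t)].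

Fixpoint free G t S : bool :=
  if t is t'.+1 then
    free G t' S &&
    ~~ [exists f in lines_at t' S, (f \in G) && [forall S' in pts f, free G t' S']]
  else true.

(** The lines inspected in order to decide [free G t S]. *)
Fixpoint query G t S : {set L} :=
  if t is t'.+1 then
    query G t' S :|: \bigcup_(f in lines_at t' S)
      (f |: if f \in G then \bigcup_(S' in pts f) query G t' S' else set0)
  else set0.

Lemma free_anti G s t S : (s <= t)%N -> free G t S -> free G s S.
Proof.
move=> /subnKC <-; elim: (t - s)%N => [|k IH]; first by rewrite addn0.
by rewrite addnS /= => /andP[/IH].
Qed.

Lemma query_lab G t S f : f \in query G t S -> (f \in K) && (lab f < t)%N.
Proof.
elim: t S => [|t IH] S /=; first by rewrite inE.
have sub S' : f \in query G t S' -> (f \in K) && (lab f < t.+1)%N.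
  by move=> /IH /andP[-> /ltnW].
rewrite in_setU => /orP[/sub //|/bigcupP[g]].
rewrite inE => /and3P[gK Sg /eqP gt] /setU1P[-> |].
  by rewrite gK gt ltnSn.
by case: ifP => _; rewrite ?inE // => /bigcupP[S' _ /sub].
Qed.

Lemma free_query G G' t S : {in query G t S, G =i G'} ->
  free G' t S = free G t S /\ query G' t S = query G t S.
Proof.
elim: t S => [//|t IH] S /= eqG.
have [|-> ->] := IH S; first by move=> f fq; apply: eqG; rewrite in_setU fq.
have eqf f : f \in lines_at t S -> (f \in G') = (f \in G).
  move=> fS; rewrite eqG // in_setU; apply/orP; right.
  by apply/bigcupP; exists f => //; rewrite setU11.
have eqS f S' : f \in lines_at t S -> f \in G -> S' \in pts f ->
    free G' t S' = free G t S' /\ query G' t S' = query G t S'.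
  move=> fS fG S'f; apply: IH => g gq; apply: eqG; rewrite in_setU; apply/orP; right.
  apply/bigcupP; exists f => //; rewrite in_setU fG; apply/orP; right.
  by apply/bigcupP; exists S'.
split.
  congr (_ && ~~ _); apply: eq_existsb => f.
  case: (boolP (f \in lines_at t S)) => //= fS; rewrite eqf //.
  case: (boolP (f \in G)) => //= fG; apply: eq_forallb => S'.
  by case: (boolP (S' \in pts f)) => //= S'f; have [-> _] := eqS f S' fS fG S'f.
congr (_ :|: _); apply: eq_bigr => f fS; rewrite eqf //.
congr (_ :|: _); case: ifP => // fG; apply: eq_bigr => S' S'f.
by have [_ ->] := eqS f S' fS fG S'f.
Qed.

Lemma free_past G G' t S : (forall f, (lab f < t)%N -> (f \in G) = (f \in G')) ->
  free G' t S = free G t S /\ query G' t S = query G t S.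
Proof. by move=> GG'; apply: free_query => f /query_lab /andP[_ /GG']. Qed.

Lemma past_setU1D1 G f t S : lab f = t ->
  free (f |: G) t S = free (G :\ f) t S /\ query (f |: G) t S = query (G :\ f) t S.
Proof.
move=> ft; apply: free_past => g; rewrite !inE; case: eqP => [->|//].
by rewrite ft ltnn.
Qed.

(** Labels strictly decrease along an exploration, so it cannot return to [f]
    after having used it: whether [f] is inspected does not depend on whether
    [f] is present.  This is what [decoupling] needs. *)
Lemma query_self f G t S : (f \in query (f |: G) t S) = (f \in query (G :\ f) t S).
Proof.
elim: t S => [//|t IH] S /=; rewrite !in_setU IH; congr (_ || _).
apply/bigcupP/bigcupP => -[g gS]; rewrite in_setU1; case: eqP => [fg _|/nesym/eqP gf] /=.
- by exists g => //; rewrite in_setU1 fg eqxx.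
- rewrite in_setU1 (negbTE gf) /= => H; exists g => //; rewrite in_setU1 in_setD1 gf.
  case: ifP H => [gG|]; rewrite ?inE // => /bigcupP[S' S'g]; rewrite IH => H.
  by apply/orP; right; apply/bigcupP; exists S'.
- by exists g => //; rewrite in_setU1 fg eqxx.
- rewrite in_setD1 gf /= => H; exists g => //; rewrite in_setU1 in_setU1 (negbTE gf) /=.
  case: ifP H => [gG|]; rewrite ?inE // => /bigcupP[S' S'g]; rewrite -IH => H.
  by apply/orP; right; apply/bigcupP; exists S'.
Qed.

Variables (P0 : {set P}) (r n d : nat).
Hypothesis uniform : forall f, f \in K -> #|pts f| = r.
Hypothesis ptsP0 : forall f, f \in K -> pts f \subset P0.
Hypothesis linear : forall f g, f \in K -> g \in K -> f != g ->
  (#|pts f :&: pts g| <= 1)%N.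
Hypothesis proper : forall f g S, f \in K -> g \in K -> S \in pts f -> S \in pts g ->
  lab f = lab g -> f = g.
Hypothesis lab_lt : forall f, f \in K -> (lab f < n)%N.
Hypothesis degree : forall S, S \in P0 -> (n <= #|[set f in K | S \in pts f]| + d)%N.

Variant lines_at_spec t S : {set L} -> Type :=
| Lines0 : lines_at_spec t S set0
| Lines1 f of f \in K & S \in pts f & lab f = t : lines_at_spec t S [set f].

Lemma lines_atP t S : lines_at_spec t S (lines_at t S).
Proof.
have [->|[f fS]] := set_0Vmem (lines_at t S); first exact: Lines0.
have := fS; rewrite inE => /and3P[fK Sf /eqP ft].
suff -> : lines_at t S = [set f] by exact: Lines1.
apply/setP => g; rewrite in_set1; apply/idP/eqP => [|-> //].
by rewrite inE => /and3P[gK Sg /eqP gt]; apply: proper gK fK Sg Sf _; rewrite gt.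
Qed.

Lemma card_through S : (#|[set f in K | S \in pts f]| <= n)%N.
Proof.
have [/eqP|/card_gt0P[f0]] := posnP #|[set f in K | S \in pts f]|; first by move=> /eqP ->.
rewrite inE => /andP[/lab_lt]; case: n lab_lt => // n' lt_lab _ _.
rewrite -[n'.+1]card_ord -(card_in_imset (f := fun f => inord (lab f) : 'I_n'.+1)).
  exact: max_card.
move=> f g; rewrite !inE => /andP[fK Sf] /andP[gK Sg] /(congr1 val) /=.
by rewrite !inordK ?lt_lab //; apply: proper fK gK Sf Sg.
Qed.

Definition greedy G : {set L} :=
  [set f in G :&: K | [forall S in pts f, free G (lab f) S]].

Lemma greedy_disjoint G f g : f \in greedy G -> g \in greedy G -> f != g ->
  [disjoint pts f & pts g].
Proof.
wlog le_fg : f g / (lab f <= lab g)%N.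
  move=> W fM gM fg; case: (leqP (lab f) (lab g)) => [le|/ltnW le]; first exact: W.
  by rewrite disjoint_sym; apply: W => //; rewrite eq_sym.
rewrite !inE => /andP[/andP[fG fK] /forall_inP fF] /andP[/andP[gG gK] /forall_inP gF] fg.
apply/pred0Pn => -[S /= /andP[Sf Sg]].
have lt_fg : (lab f < lab g)%N.
  rewrite ltn_neqAle le_fg andbT; apply: contra fg => /eqP eq_lab.
  by apply/eqP; apply: proper Sf Sg eq_lab.
have /= /andP[_ /negP[]] := free_anti lt_fg (gF S Sg).
apply/exists_inP; exists f; first by rewrite inE fK Sf eqxx.
by rewrite fG; apply/forall_inP.
Qed.

Lemma not_free_greedy G t S : ~~ free G t S -> exists2 f, f \in greedy G & S \in pts f.
Proof.
elim: t => [//|t IH] /=; rewrite negb_and negbK => /orP[/IH //|/exists_inP[f]].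
rewrite inE => /and3P[fK Sf /eqP ft] /andP[fG fF].
by exists f => //; rewrite !inE fG fK ft.
Qed.

Lemma card_not_free G t : (#|[set S | ~~ free G t S]| <= r * #|greedy G|)%N.
Proof.
apply: (@leq_trans #|\bigcup_(f in greedy G) pts f|).
  apply: subset_leq_card; apply/subsetP => S; rewrite inE => /not_free_greedy[f fM Sf].
  by apply/bigcupP; exists f.
rewrite mulnC -sum_nat_const; elim/big_rec2: _ => [|f k A fM Ak]; first by rewrite cards0.
rewrite cardsU (leq_trans (leq_subr _ _)) // leq_add // uniform //.
by move: fM; rewrite !inE => /andP[/andP[]].
Qed.

Section Expectation.
Variables (R : realFieldType) (p : R).
Hypothesis p01 : 0 <= p <= 1.
Let p_ge0 : 0 <= p. Proof. by case/andP: p01. Qed.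

Let E := Ex p K.
Definition free_prob t S : R := E (fun G => (free G t S)%:R).
Definition query_prob t S f : R := E (fun G => (f \in query G t S)%:R).
Definition all_free_prob t (A : {set P}) : R :=
  E (fun G => [forall S in A, free G t S]%:R).

Lemma Ebool01 (b : {set L} -> bool) : 0 <= E (fun G => (b G)%:R) <= 1.
Proof.
apply/andP; split; first by apply: Ex_ge0.
by rewrite -[leRHS](Ex_cst p K); apply: ler_Ex => // G _; rewrite lern1 leq_b1.
Qed.

Lemma query_prob_ge0 t S f : 0 <= query_prob t S f.
Proof. by case/andP: (Ebool01 (fun G => f \in query G t S)). Qed.
Lemma query_prob_le1 t S f : query_prob t S f <= 1.
Proof. by case/andP: (Ebool01 (fun G => f \in query G t S)). Qed.

(** Reading label [t] at [S] inspects the only line there and, with probability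
    [p], continues from its points. *)
Lemma query_prob_step t S f : query_prob t.+1 S f <= query_prob t S f +
  \sum_(g in lines_at t S) ((f == g)%:R + p * \sum_(S' in pts g) query_prob t S' f).
Proof.
have -> : \sum_(g in lines_at t S) ((f == g)%:R + p * \sum_(S' in pts g) query_prob t S' f) =
  E (fun G => \sum_(g in lines_at t S) ((f == g)%:R +
       (g \in G)%:R * \sum_(S' in pts g) (f \in query G t S')%:R)).
  rewrite /E Ex_sum; apply: eq_bigr => g; rewrite inE => /and3P[gK Sg /eqP gt].
  rewrite ExD Ex_cst Ex_mem ?Ex_sum // => G.
  by apply: eq_bigr => S' _; have [_ ->] := past_setU1D1 G S' gt.
rewrite -ExD; apply: ler_Ex => // G _ /=.
have s0 g : 0 <= (f == g)%:R + (g \in G)%:R * \sum_(S' in pts g) (f \in query G t S')%:R :> R.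
  by rewrite addr_ge0 ?mulr_ge0 ?sumr_ge0.
rewrite in_setU; case: (boolP (f \in query G t S)) => [_|_] /=.
  by rewrite lerDl sumr_ge0.
rewrite add0r; case: (boolP (f \in \bigcup_(_ in _) _)) => [|_]; last exact: sumr_ge0.
case/bigcupP => g gS fg; rewrite (bigD1 g) //= ler_wpDr ?sumr_ge0 //.
move: fg; rewrite in_setU1; case: eqP => [_ _|_ /=].
  by rewrite lerDl mulr_ge0 ?sumr_ge0.
case: ifP => [gG|]; rewrite ?inE // => /bigcupP[S' S'g fS'].
by rewrite add0r mul1r (bigD1 S') //= fS' lerDl sumr_ge0.
Qed.

Definition meet_count t S f : nat :=
  \sum_(s < t) \sum_(g in lines_at s S) #|pts g :&: pts f|.

(** By linearity at most one line joins [S] to each of the [r] points of [f]. *)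
Lemma meet_count_le t S f : f \in K -> S \notin pts f -> (meet_count t S f <= r)%N.
Proof.
move=> fK Sf; rewrite -(uniform fK) -sum1_card.
have -> : meet_count t S f =
    (\sum_(S' in pts f) \sum_(s < t) #|lines_at s S :&: [set g | S' \in pts g]|)%N.
  rewrite exchange_big; apply: eq_bigr => s _ /=.
  transitivity (\sum_(g in lines_at s S) \sum_(S' in pts f) (S' \in pts g))%N.
    by apply: eq_bigr => g _; rewrite sum_nat_in setIC; apply: eq_card => S'; rewrite !inE.
  rewrite exchange_big; apply: eq_bigr => S' _ /=.
  by rewrite sum_nat_in; apply: eq_card => g; rewrite !inE.
apply: leq_sum => S' S'f.
have SS' : S != S' by apply: contraNneq Sf => ->.
have uniq2 g g' : g \in K -> g' \in K -> S \in pts g -> S' \in pts g ->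
    S \in pts g' -> S' \in pts g' -> g = g'.
  move=> gK g'K Sg S'g Sg' S'g'; apply/eqP; apply: contraT => /(linear gK g'K).
  rewrite leqNgt => /negP[]; apply: (@leq_trans #|[set S; S']|); first by rewrite cards2 SS'.
  by apply: subset_leq_card; apply/subsetP => x /set2P[] ->; rewrite inE; apply/andP.
have [/existsP[s0 /card_gt0P[g0 g0S]]|/existsPn none] :=
    boolP [exists s : 'I_t, 0 < #|lines_at s S :&: [set g | S' \in pts g]|]%N; last first.
  by rewrite big1 // => s _; apply/eqP; rewrite -leqn0 leqNgt.
move: g0S; rewrite !inE => /andP[/and3P[g0K Sg0 /eqP g0s] S'g0].
rewrite (bigD1 s0) //= big1 => [|s ss0].
  rewrite addn0 -(cards1 g0); apply: subset_leq_card; apply/subsetP => g.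
  rewrite !inE => /andP[/and3P[gK Sg _] S'g]; apply/eqP; exact: uniq2.
apply/eqP; rewrite cards_eq0; apply/set0Pn => -[g].
rewrite !inE => /andP[/and3P[gK Sg /eqP gs] S'g].
by case/negP: ss0; apply/eqP/ord_inj; rewrite -gs -g0s; congr lab; exact: uniq2.
Qed.

Let A := 1 + p * r%:R.
Let A_ge1 : 1 <= A. Proof. by rewrite lerDl mulr_ge0. Qed.
Let An_ge1 t : 1 <= A ^+ t. Proof. exact: exprn_ege1. Qed.
Let An_le s t : (s <= t)%N -> A ^+ s <= A ^+ t. Proof. exact: ler_weXn2l. Qed.

(** A line off [S] is reached through one of the at most [r] lines joining it to
    [S], each present with probability [p], or through longer paths; the decrease
    of the labels makes their contributions sum to an exponential. *)
Lemma query_prob_off t S f : f \in K -> S \notin pts f ->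
  query_prob t S f <= p * (meet_count t S f)%:R + p * r%:R * (A ^+ t - 1).
Proof.
move=> fK; elim: t S => [|t IH] S Sf.
  rewrite /query_prob /= expr0 subrr mulr0 addr0 /E.
  by rewrite (@Ex_eq_cst _ _ _ _ _ 0) ?mulr_ge0 // => G _; rewrite inE.
apply: (le_trans (query_prob_step t S f)).
have H0 : p * r%:R * (A ^+ t - 1) <= p * r%:R * (A ^+ t.+1 - 1).
  by rewrite ler_wpM2l ?mulr_ge0 // lerB // An_le.
have meetsS : meet_count t.+1 S f =
    (meet_count t S f + \sum_(g in lines_at t S) #|pts g :&: pts f|)%N.
  by rewrite /meet_count big_ord_recr.
rewrite meetsS natrD mulrDr; case: (lines_atP t S) => [|g gK Sg gt].
  by rewrite !big_set0 mulr0 !addr0; apply: (le_trans (IH S Sf)); rewrite lerD2l.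
rewrite !big_set1 (_ : (f == g) = false); last by apply/eqP => fg; rewrite fg Sg in Sf.
rewrite add0r.
have B S' : query_prob t S' f <= (S' \in pts f)%:R + p * r%:R * A ^+ t.
  case: (boolP (S' \in pts f)) => S'f.
    by rewrite (le_trans (query_prob_le1 _ _ _)) // lerDl !mulr_ge0 //
      exprn_ge0 // (le_trans ler01).
  rewrite add0r (le_trans (IH S' S'f)) // -lerBrDr -mulrBr.
  rewrite opprB addrCA subrr addr0 mulr1 ler_wpM2l // ler_nat; exact: meet_count_le.
have {}B : \sum_(S' in pts g) query_prob t S' f <=
    #|pts g :&: pts f|%:R + r%:R * (p * r%:R * A ^+ t).
  apply: (le_trans (ler_sum _ (fun S' _ => B S'))); rewrite big_split /= lerD //.
    rewrite -natr_sum ler_nat sum_nat_in.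
    by apply: subset_leq_card; apply/subsetP => S'; rewrite !inE.
  by rewrite sumr_const uniform // mulr_natl.
apply: (le_trans (lerD (IH S Sf) (ler_wpM2l p_ge0 B))).
rewrite /A exprS -/A; set a := A ^+ t.
by rewrite le_eqVlt; apply/orP; left; apply/eqP; rewrite /A; ring.
Qed.

Lemma query_prob_total t S : \sum_(f in K) query_prob t S f <= t%:R * A ^+ t.
Proof.
elim: t S => [|t IH] S.
  rewrite mul0r big1 // => f _; rewrite /query_prob /= /E.
  by apply: Ex_eq_cst => G _; rewrite inE.
apply: (le_trans (ler_sum _ (fun f _ => query_prob_step t S f))); rewrite big_split /=.
have A0 : 0 <= t%:R * A ^+ t by rewrite mulr_ge0 // exprn_ge0 // (le_trans ler01).
rewrite -natr1 exprS.
have A1 := An_ge1 t; have pr0 : 0 <= p * r%:R by rewrite mulr_ge0.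
case: (lines_atP t S) => [|g gK Sg gt].
  rewrite [X in _ + X]big1 => [|f _]; last by rewrite big_set0.
  by rewrite addr0 (le_trans (IH S)) // /A; nra.
rewrite [X in _ + X](_ : _ =
  1 + p * \sum_(S' in pts g) \sum_(f in K) query_prob t S' f); last first.
  under eq_bigr do rewrite big_set1.
  rewrite big_split /= (bigD1 g) //= eqxx big1 => [|f /andP[_ /negbTE ->]] //.
  by rewrite addr0 -big_distrr /= exchange_big.
have B : \sum_(S' in pts g) \sum_(f in K) query_prob t S' f <= r%:R * (t%:R * A ^+ t).
  apply: (le_trans (ler_sum _ (fun S' _ => IH S'))).
  by rewrite sumr_const uniform // -[leLHS]mulr_natl.
apply: (le_trans (lerD (IH S) (lerD (lexx 1) (ler_wpM2l p_ge0 B)))).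
move: A1; set a := A ^+ t => A1; rewrite /A.
have : 0 <= p * r%:R * a by rewrite mulr_ge0 // (le_trans ler01).
by lra.
Qed.

Definition overlap_bound : R := 1 + n%:R * (p * r%:R * A ^+ n) * (1 + A ^+ n).

Lemma overlap_bound_ge0 : 0 <= overlap_bound.
Proof.
have A0 : 0 <= A ^+ n by rewrite (le_trans ler01).
by rewrite /overlap_bound addr_ge0 // mulr_ge0 ?addr_ge0 // !mulr_ge0.
Qed.

(** The expected overlap of independent explorations from two points is bounded,
    although each of them reads about [n] lines.  Hence the factor [p] in
    [decoupling] makes the covariance O(p). *)
Lemma query_prob_pair t S1 S2 : (t <= n)%N -> S1 != S2 ->
  \sum_(f in K) query_prob t S1 f * query_prob t S2 f <= overlap_bound.
Proof.
move=> tn S12; have A0 : 0 <= A ^+ n by rewrite (le_trans ler01).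
pose b := p * r%:R * A ^+ n.
have b0 : 0 <= b by rewrite !mulr_ge0.
have off S f : f \in K -> query_prob t S f <= (S \in pts f)%:R + b.
  move=> fK; case: (boolP (S \in pts f)) => Sf.
    by rewrite (le_trans (query_prob_le1 _ _ _)) // lerDl.
  rewrite add0r (le_trans (query_prob_off t fK Sf)) //.
  have : (meet_count t S f)%:R <= r%:R :> R by rewrite ler_nat meet_count_le.
  have := An_le tn; have := An_ge1 t; rewrite /b => H1 H2 H3.
  apply: (@le_trans _ _ (p * r%:R * A ^+ t)); last by rewrite ler_wpM2l ?mulr_ge0.
  by rewrite mulrBr mulr1 addrCA gerDl subr_le0 ler_wpM2l.
have step f : f \in K -> query_prob t S1 f * query_prob t S2 f <=
    ((S1 \in pts f) && (S2 \in pts f))%:R + (S2 \in pts f)%:R * b + b * query_prob t S1 f.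
  move=> fK; apply: (le_trans (ler_wpM2l (query_prob_ge0 _ _ _) (off S2 f fK))).
  rewrite mulrDr [query_prob t S1 f * b]mulrC lerD2r.
  have := off S1 f fK; case: (S2 \in pts f); rewrite ?andbT ?andbF ?mulr1 ?mul1r //.
  by rewrite mulr0 mul0r addr0.
apply: (le_trans (ler_sum _ step)); rewrite !big_split /= -natr_sum -big_distrl /= -big_distrr /=.
rewrite /overlap_bound -/b -addrA mulrDr mulr1; apply: lerD; last apply: lerD.
- rewrite lern1 sum_nat_in.
  apply/card_le1_eqP => g f; rewrite !inE => /and3P[gK S1g S2g] /and3P[fK S1f S2f].
  apply/eqP; apply: contraT => /(linear fK gK).
  rewrite leqNgt => /negP[]; apply: (@leq_trans #|[set S1; S2]|); first by rewrite cards2 S12.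
  by apply: subset_leq_card; apply/subsetP => x /set2P[] ->; rewrite inE; apply/andP.
- rewrite ler_wpM2r // -natr_sum ler_nat sum_nat_in.
  by apply: leq_trans (card_through S2); apply: subset_leq_card; apply/subsetP => f; rewrite !inE.
- rewrite -mulrA mulrCA ler_wpM2l //; apply: (le_trans (query_prob_total t S1)).
  by rewrite ler_pM ?ler_nat ?An_le // exprn_ge0 // (le_trans ler01).
Qed.

Lemma all_free_prob_prod t (B : {set P}) : (t <= n)%N ->
  `|all_free_prob t B - \prod_(S in B) free_prob t S| <= #|B|%:R ^+ 2 * (2 * p * overlap_bound).
Proof.
move=> tn; have k0 := overlap_bound_ge0.
elim/set_ind_D1: B => [|B S SB IH].
  rewrite big_set0 cards0 expr0n /= mul0r /all_free_prob /E (@Ex_eq_cst _ _ _ _ _ 1) => [|G _].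
    by rewrite subrr normr0.
  by rewrite (_ : [forall S in set0, _] = true) //; apply/forall_inP => S; rewrite inE.
pose B' := B :\ S.
have eF : all_free_prob t B = E (fun G => (free G t S && [forall S' in B', free G t S'])%:R).
  apply: eq_Ex => G _; congr (nat_of_bool _)%:R.
  apply/forall_inP/andP => [H|[HS /forall_inP H] S' S'B].
    by split; [exact: H|apply/forall_inP => S' /setD1P[_]; exact: H].
  by have [->//|S'S] := eqVneq S' S; apply: H; rewrite in_setD1 S'S.
pose Qh G := \bigcup_(S' in B') query G t S'.
have agree G G' : {in Qh G, G =i G'} -> forall S', S' \in B' ->
   free G' t S' = free G t S' /\ query G' t S' = query G t S'.
  by move=> GG' S' S'B; apply: free_query => f fq; apply: GG'; apply/bigcupP; exists S'.
have D : `|all_free_prob t B - free_prob t S * all_free_prob t B'| <=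
    2 * p * \sum_(f in K) query_prob t S f * E (fun G => (f \in Qh G)%:R).
  rewrite eF; apply: (decoupling (Qg := fun G => query G t S) (g := fun G => free G t S)
    (h := fun G => [forall S' in B', free G t S'])) => //.
  - by move=> G G' /agree GG'; apply: eq_bigr => S' S'B; have [] := GG' S' S'B.
  - move=> G G' /agree GG'; apply: eq_forallb => S'; case: (boolP (S' \in B')) => //= S'B.
    by have [] := GG' S' S'B.
  - by move=> G G' /free_query[].
  - by move=> G; apply/subsetP => f /query_lab /andP[].
  - by move=> f G; exact: query_self.
  - move=> f G; apply/bigcupP/bigcupP => -[S' S'B].
      by rewrite query_self; exists S'.
    by rewrite -query_self; exists S'.
rewrite (bigD1 S) //= (eq_bigl (fun S' => S' \in B')); last first.
  by move=> S'; rewrite in_setD1 andbC.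
move: IH; rewrite (cardsD1 S B) SB -/B' /=; set k : R := #|B'|%:R; set pi := \prod_(_ in _) _.
move=> IH.
have {}D : `|all_free_prob t B - free_prob t S * all_free_prob t B'| <= 2 * p * (k * overlap_bound).
  apply: (le_trans D); rewrite ler_wpM2l ?mulr_ge0 //.
  apply: (@le_trans _ _ (\sum_(S' in B') \sum_(f in K) query_prob t S f * query_prob t S' f)).
    rewrite exchange_big /=; apply: ler_sum => f fK; rewrite -big_distrr /=.
    rewrite ler_wpM2l ?query_prob_ge0 // -Ex_sum; apply: ler_Ex => // G _.
    rewrite -natr_sum; case: (boolP (f \in Qh G)) => // /bigcupP[S' S'B fS'].
    by rewrite ler_nat (bigD1 S') //= fS'.
  rewrite mulr_natl -sumr_const; apply: ler_sum => S' /setD1P[S'S _].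
  by apply: query_prob_pair => //; rewrite eq_sym.
have x01 : 0 <= free_prob t S <= 1 by exact: Ebool01.
have k00 : 0 <= k by [].
rewrite natrD -/k.
have -> : all_free_prob t B - free_prob t S * pi =
   (all_free_prob t B - free_prob t S * all_free_prob t B') +
   free_prob t S * (all_free_prob t B' - pi) by ring.
apply: (le_trans (ler_normD _ _)); rewrite normrM.
have [x0 x1] := andP x01; rewrite (ger0_norm x0).
have H : free_prob t S * `|all_free_prob t B' - pi| <= k ^+ 2 * (2 * p * overlap_bound).
  by apply: le_trans IH; rewrite ler_piMl.
apply: (le_trans (lerD D H)).
have : 0 <= p * overlap_bound by rewrite mulr_ge0.
have : 0 <= k * (p * overlap_bound) by rewrite mulr_ge0 ?mulr_ge0.
by set q := p * overlap_bound; rewrite -!mulrA -/q mulrCA [p * _]mulrCA -/q => *; nra.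
Qed.

Lemma free_prob_step t S :
  free_prob t.+1 S = free_prob t S - p * \sum_(f in lines_at t S) all_free_prob t (pts f).
Proof.
have -> : p * \sum_(f in lines_at t S) all_free_prob t (pts f) =
  E (fun G => \sum_(f in lines_at t S) (f \in G)%:R * [forall S' in pts f, free G t S']%:R).
  rewrite /E Ex_sum big_distrr; apply: eq_bigr => f; rewrite inE => /and3P[fK Sf /eqP ft].
  rewrite Ex_mem // => G; congr (nat_of_bool _)%:R; apply: eq_forallb => S'.
  by have [-> _] := past_setU1D1 G S' ft.
rewrite -ExB; apply: eq_Ex => G _ /=; case: (lines_atP t S) => [|f fK Sf ft].
  rewrite big_set0 subr0 (_ : [exists f in set0, _] = false) ?andbT //.
  by apply/negbTE/exists_inPn => f; rewrite inE.
rewrite big_set1 (_ : [exists f0 in [set f], _] = (f \in G) && [forall S' in pts f, free G t S']).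
  case: (boolP (f \in G)) => fG /=; rewrite ?mul0r ?subr0 ?andbT ?mul1r //.
  case: (boolP [forall _ in _, _]) => [/forall_inP ->|_] //=; rewrite ?subrr ?subr0 ?andbT //.
apply/exists_inP/idP => [[g /set1P -> //]|H]; by exists f; rewrite ?set11.
Qed.

(** The probability that a point is free, if the points of a line were free
    independently and every label occurred at every point. *)
Fixpoint free_seq t : R := if t is t'.+1 then free_seq t' - p * free_seq t' ^+ r else 1.

Hypothesis r_gt0 : (0 < r)%N.

Lemma free_seq01 t : 0 <= free_seq t <= 1.
Proof.
elim: t => [|t /andP[u0 u1]] /=; first by rewrite ler01 lexx.
have [p0 p1] := andP p01.
have ur0 : 0 <= free_seq t ^+ r by rewrite exprn_ge0.
have ur : free_seq t ^+ r <= free_seq t.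
  by rewrite -[leRHS]expr1 ler_wiXn2l.
by apply/andP; split; nra.
Qed.

(** The inequality says that [free_seq t ^- r.-1] grows by at least [r.-1 * p] per
    step, as for the solution of u' = - u ^ r. *)
Lemma free_seq_bound t : free_seq t ^+ r.-1 * (1 + r.-1%:R * (p * t%:R)) <= 1.
Proof.
elim: t => [|t IH]; first by rewrite /= expr1n mulr0 mulr0 addr0 mulr1.
have [p0 p1] := andP p01; have /andP[u0 u1] := free_seq01 t.
rewrite /= (_ : free_seq t ^+ r = free_seq t * free_seq t ^+ r.-1); last by rewrite -exprS prednK.
set q := r.-1 in IH *; set v := free_seq t in IH u0 u1 *.
have v0 : 0 <= v ^+ q by rewrite exprn_ge0.
have v1 : v ^+ q <= 1 by rewrite exprn_ile1.
pose w := p * v ^+ q.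
have w0 : 0 <= w by rewrite mulr_ge0.
have w1 : w <= 1 by rewrite /w; nra.
have -> : v - p * (v * v ^+ q) = v * (1 - w) by rewrite /w; ring.
rewrite exprMn.
have B : 1 + q%:R * w <= (1 + w) ^+ q.
  by apply: bernoulli_ge; lra.
have C : (1 - w) ^+ q * (1 + q%:R * w) <= 1.
  apply: (@le_trans _ _ ((1 - w) ^+ q * (1 + w) ^+ q)).
    by rewrite ler_wpM2l // exprn_ge0 // subr_ge0.
  by rewrite -exprMn exprn_ile1 //; nra.
apply: le_trans C; rewrite -natr1.
have -> : v ^+ q * (1 - w) ^+ q * (1 + q%:R * (p * (t%:R + 1))) =
  (1 - w) ^+ q * (v ^+ q * (1 + q%:R * (p * t%:R)) + q%:R * w) by rewrite /w; ring.
by rewrite ler_wpM2l ?lerD2r // exprn_ge0 // subr_ge0.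
Qed.

Lemma prod_sub_norm (I : finType) (B : {set I}) (a b : I -> R) :
  (forall i, 0 <= a i <= 1) -> (forall i, 0 <= b i <= 1) ->
  `|\prod_(i in B) a i - \prod_(i in B) b i| <= \sum_(i in B) `|a i - b i|.
Proof.
move=> a01 b01; elim/set_ind_D1: B => [|B i iB IH].
  by rewrite !big_set0 subrr normr0.
rewrite (bigD1 i) //= [X in _ - X](bigD1 i) //= [leRHS](bigD1 i) //=.
have e (F : I -> R) : \prod_(j in B | j != i) F j = \prod_(j in B :\ i) F j.
  by apply: eq_bigl => j; rewrite in_setD1 andbC.
rewrite !{}e [X in _ <= _ + X](eq_bigl (fun j => j \in B :\ i)) => [|j]; last first.
  by rewrite in_setD1 andbC.
set x := \prod_(_ in _) a _ in IH *; set y := \prod_(_ in _) b _ in IH *.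
have x01 : 0 <= x <= 1.
  apply/andP; split; first by apply: prodr_ge0 => j _; have /andP[] := a01 j.
  by apply: prodr_ile1 => j _; exact: a01.
have -> : a i * x - b i * y = (a i - b i) * x + b i * (x - y) by ring.
apply: (le_trans (ler_normD _ _)); rewrite !normrM lerD //.
  by have [x0 x1] := andP x01; rewrite ler_piMr // ger0_norm.
by have /andP[b0 b1] := b01 i; apply: le_trans IH; rewrite ler_piMl // ger0_norm.
Qed.

(** Each label missing at [S] makes the true probability exceed [free_seq] by at
    most [p]. *)
Definition miss t S : nat := \sum_(s < t) (lines_at s S == set0).

Lemma miss_le t S : S \in P0 -> (t <= n)%N -> (miss t S <= d)%N.
Proof.
move=> SP tn; apply: (@leq_trans (miss n S)).
  by rewrite /miss -(subnKC tn) big_split_ord /= leq_addr.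
rewrite -(leq_add2l #|[set f in K | S \in pts f]|).
apply: leq_trans (degree SP).
rewrite [X in (_ <= X)%N](_ : n = \sum_(s < n) 1)%N; last by rewrite sum_nat_const card_ord muln1.
rewrite [X in (X + _)%N](_ : _ = \sum_(s < n) #|lines_at s S|)%N.
  rewrite -big_split /=; apply: leq_sum => s _.
  by case: (lines_atP s S) => [|f _ _ _]; rewrite ?cards0 ?eqxx // cards1 -cards_eq0 cards1.
rewrite -sum1_card.
have E1 f : f \in [set f in K | S \in pts f] -> 1%N = (\sum_(s < n) (lab f == s))%N.
  rewrite inE => /andP[/lab_lt fn _]; rewrite (bigD1 (Ordinal fn)) //= eqxx big1 // => s.
  by rewrite -val_eqE /= eq_sym => /negbTE ->.
rewrite (eq_bigr _ E1) exchange_big /=; apply: eq_bigr => s _.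
by rewrite sum_nat_in; apply: eq_card => f; rewrite !inE -andbA.
Qed.

Definition free_error : R := p * d%:R + r%:R * (2 * p * overlap_bound).

(** Gronwall's argument: the error at time [t] is multiplied by at most
    [1 + p * r] per step, and each step adds the defect of independence. *)
Lemma free_prob_seq t S : S \in P0 -> (t <= n)%N ->
  `|free_prob t S - free_seq t| <= p * (miss t S)%:R + free_error * (A ^+ t - 1).
Proof.
have k0 := overlap_bound_ge0.
have D0 : 0 <= free_error by rewrite addr_ge0 ?mulr_ge0 // mulr_ge0 ?mulr_ge0.
elim: t S => [|t IH] S SP tn.
  by rewrite /free_prob /= /E Ex_cst subrr normr0 mulr0 addr0 mulr_ge0.
have missS : miss t.+1 S = (miss t S + (lines_at t S == set0))%N by rewrite /miss big_ord_recr.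
have {}IH S' : S' \in P0 -> `|free_prob t S' - free_seq t| <=
    p * (miss t S')%:R + free_error * (A ^+ t - 1).
  by move=> S'P; apply: IH => //; apply: ltnW.
have A1 := An_ge1 t; have pr0 : 0 <= p * r%:R by rewrite mulr_ge0.
have /andP[u0 u1] := free_seq01 t; have [p0 p1] := andP p01.
have AS : free_error * (A ^+ t.+1 - 1) =
    free_error * (A ^+ t - 1) + p * r%:R * (free_error * A ^+ t).
  by rewrite exprS {1}/A; ring.
rewrite free_prob_step /= missS natrD mulrDr {}AS.
case: (lines_atP t S) => [|f fK Sf ft].
  rewrite big_set0 eqxx mulr1 mulr0 subr0.
  have -> : free_prob t S - (free_seq t - p * free_seq t ^+ r) =
    (free_prob t S - free_seq t) + p * free_seq t ^+ r by ring.
  apply: (le_trans (ler_normD _ _)).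
  have : `|p * free_seq t ^+ r| <= p.
    by rewrite ger0_norm ?mulr_ge0 ?exprn_ge0 // ler_piMr // exprn_ile1.
  have : 0 <= p * r%:R * (free_error * A ^+ t) by rewrite !mulr_ge0 // (le_trans ler01).
  by have := IH S SP => *; lra.
rewrite big_set1 -cards_eq0 cards1 /= mulr0 addr0.
have -> : free_prob t S - p * all_free_prob t (pts f) - (free_seq t - p * free_seq t ^+ r) =
  (free_prob t S - free_seq t) - p * (all_free_prob t (pts f) - free_seq t ^+ r) by ring.
apply: (le_trans (ler_normB _ _)); rewrite addrA; apply: lerD; first exact: IH.
rewrite normrM ger0_norm // -mulrA ler_wpM2l //.
have -> : all_free_prob t (pts f) - free_seq t ^+ r =
  (all_free_prob t (pts f) - \prod_(S' in pts f) free_prob t S') +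
  (\prod_(S' in pts f) free_prob t S' - \prod_(S' in pts f) free_seq t).
  by rewrite prodr_const uniform //; ring.
apply: (le_trans (ler_normD _ _)).
have H1 := @all_free_prob_prod t (pts f) (ltnW tn).
have H2 := @prod_sub_norm P (pts f) (free_prob t) (fun=> free_seq t)
  (fun S' => Ebool01 _) (fun _ => free_seq01 t).
have {}H2 : `|\prod_(i in pts f) free_prob t i - \prod_(i in pts f) free_seq t| <=
    r%:R * (p * d%:R + free_error * (A ^+ t - 1)).
  apply: (le_trans H2); rewrite mulr_natl -(uniform fK) -sumr_const.
  apply: ler_sum => S' S'f; have S'P := subsetP (ptsP0 fK) _ S'f.
  by apply: (le_trans (IH S' S'P)); rewrite lerD2r ler_wpM2l // ler_nat miss_le // ltnW.
apply: (le_trans (lerD H1 H2)); rewrite uniform //.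
rewrite le_eqVlt; apply/orP; left; apply/eqP.
by set a := A ^+ t; rewrite /free_error; ring.
Qed.

Theorem greedy_size :
  #|P0|%:R * (1 - free_seq n - free_error * A ^+ n) <= r%:R * E (fun G => #|greedy G|%:R).
Proof.
have D0 : 0 <= free_error.
  by have k0 := overlap_bound_ge0; rewrite addr_ge0 ?mulr_ge0 // mulr_ge0 ?mulr_ge0.
apply: (@le_trans _ _ (\sum_(S in P0) (1 - free_prob n S))).
  rewrite mulr_natl -sumr_const; apply: ler_sum => S SP.
  have := free_prob_seq SP (leqnn n); rewrite ler_norml => /andP[_].
  have : p * (miss n S)%:R <= p * d%:R by rewrite ler_wpM2l // ler_nat miss_le.
  have : p * d%:R <= free_error by rewrite lerDl !mulr_ge0 // overlap_bound_ge0.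
  by lra.
have -> : \sum_(S in P0) (1 - free_prob n S) = E (fun G => \sum_(S in P0) (~~ free G n S)%:R).
  rewrite /E Ex_sum; apply: eq_bigr => S _; rewrite /free_prob /E -[X in X - _](Ex_cst p K) -ExB.
  by apply: eq_Ex => G _; case: (free _ _ _) => /=; ring.
rewrite -ExZ; apply: ler_Ex => // G _; rewrite -natr_sum -natrM ler_nat.
apply: leq_trans (card_not_free G n); rewrite sum_nat_in.
by apply: subset_leq_card; apply/subsetP => S; rewrite !inE => /andP[].
Qed.

End Expectation.
End Greedy.

(** * Matchings and covers of uniform hypergraphs *)

Section NuTau.
Variable V : finType.
Implicit Types (k r : nat) (G M C : {set {set V}}) (e f S : {set V}).

Lemma ksubset_exists k (A : {set V}) : (k <= #|A|)%N ->
  exists2 S : {set V}, S \subset A & #|S| = k.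
Proof.
move=> kA.
have /card_gt0P[S] : (0 < #|[set S : {set V} | S \subset A & #|S| == k]|)%N.
  by rewrite cards_draws bin_gt0.
by rewrite inE => /andP[SA /eqP Sk]; exists S.
Qed.

Lemma nu_mono k G G' : G \subset G' -> (nu k G <= nu k G')%N.
Proof.
move=> GG'; have [[M /andP[MG Mm] <-] _] := nuP k G.
by have [_ ->] := nuP k G'; rewrite // /is_matching (subset_trans MG).
Qed.

Lemma nu_setU1 k G e : (nu k (e |: G) <= (nu k G).+1)%N.
Proof.
have [[M /andP[MG Mm] <-] _] := nuP k (e |: G).
apply: (@leq_trans (#|M :\ e|).+1).
  by rewrite (cardsD1 e M); case: (e \in M).
rewrite ltnS; have [_ ->] := nuP k G => //; apply/andP; split.
  apply/subsetP => f /setD1P[fe fM]; move: (subsetP MG f fM).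
  by rewrite in_setU1 (negbTE fe).
apply/forall_inP => f /setD1P[_ fM]; apply/forall_inP => g /setD1P[_ gM].
by have /forall_inP/(_ f fM)/forall_inP/(_ g gM) := Mm.
Qed.

Lemma is_rgraphS r G G' : G \subset G' -> is_rgraph r G' -> is_rgraph r G.
Proof. exact: subset_trans. Qed.

Lemma tau_mono k r G G' : (k <= r)%N -> is_rgraph r G' -> G \subset G' ->
  (tau k G <= tau k G')%N.
Proof.
move=> kr rG' GG'.
have [[C /andP[Ck /forall_inP CG] <-] _] := tauP kr rG'.
have [_ ->] := tauP kr (is_rgraphS GG' rG') => //.
by rewrite /is_cover Ck; apply/forall_inP => e /(subsetP GG'); exact: CG.
Qed.

Lemma tau_setU1 k r G e : (k <= r)%N -> is_rgraph r (e |: G) ->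
  (tau k (e |: G) <= (tau k G).+1)%N.
Proof.
move=> kr rG.
have rG0 : is_rgraph r G by apply: is_rgraphS rG; exact: subsetUr.
have [[C /andP[Ck /forall_inP CG] <-] _] := tauP kr rG0.
have er : #|e| = r.
  by have /subsetP/(_ e) := rG; rewrite setU11 inE => /(_ isT) /eqP.
have [|S Se Sk] := @ksubset_exists k e; first by rewrite er.
have [_ H] := tauP kr rG.
apply: (leq_trans (H (S |: C) _)); last by rewrite cardsU1; case: (S \notin C).
apply/andP; split; first by rewrite subUset Ck sub1set inE Sk eqxx.
apply/forall_inP => f /setU1P[->|fG]; apply/exists_inP; first by exists S; rewrite ?setU11.
by have /exists_inP[S' S'C S'f] := CG f fG; exists S' => //; rewrite in_setU1 S'C orbT.
Qed.

Lemma tau_le_card k r G : (k <= r)%N -> is_rgraph r G -> (tau k G <= #|G|)%N.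
Proof.
move=> kr; elim/set_ind_D1: G => [|G e eG IH] rG.
  have [_ H] := tauP kr rG; apply: H; rewrite /is_cover sub0set.
  by apply/forall_inP => e; rewrite inE.
rewrite (cardsD1 e) eG add1n -{1}(setD1K eG).
apply: leq_trans (tau_setU1 kr _) _; first by rewrite setD1K.
by rewrite ltnS IH //; apply: is_rgraphS rG; exact: subD1set.
Qed.

End NuTau.

Lemma card_ksets n k : #|ksets 'I_n k| = 'C(n, k).
Proof. by rewrite card_draws card_ord. Qed.

Section CompleteHypergraph.
Variables (n k : nat).
Let V := 'I_n.
Let K := ksets V k.+1.
Let P0 := ksets V k.
Implicit Types (f g S : {set V}).

Definition faces f : {set {set V}} := [set S : {set V} | S \subset f & #|S| == k].
(** Completing a k-set by a vertex shifts the sum by that vertex, so the labels of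
    the lines through a k-set are distinct residues. *)
Definition label f : nat := (\sum_(i in f) i) %% n.

Lemma faces_uniform f : f \in K -> #|faces f| = k.+1.
Proof. by rewrite inE => /eqP fk; rewrite cards_draws fk binSn. Qed.

Lemma faces_sub f : f \in K -> faces f \subset P0.
Proof. by move=> _; apply/subsetP => S; rewrite !inE => /andP[]. Qed.

Lemma faces_linear f g : f \in K -> g \in K -> f != g -> (#|faces f :&: faces g| <= 1)%N.
Proof.
rewrite !inE => /eqP fk /eqP gk fg.
have fgk : (#|f :&: g| <= k)%N.
  rewrite -ltnS -fk proper_card // properE subsetIl subsetI subxx /=.
  by apply: contra fg => sfg; rewrite eqEcard sfg fk gk leqnn.
apply: (@leq_trans 'C(#|f :&: g|, k)).
  rewrite -cards_draws; apply: subset_leq_card; apply/subsetP => S.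
  by rewrite !inE subsetI => /andP[/andP[-> ->] /andP[-> _]].
by move: fgk; rewrite leq_eqVlt => /orP[/eqP ->|/bin_small ->]; rewrite ?binn.
Qed.

Lemma face_ext f S : f \in K -> S \in faces f -> exists2 v, v \notin S & f = v |: S.
Proof.
rewrite !inE => /eqP fk /andP[Sf /eqP Sk].
have /card_gt0P[v] : (0 < #|f :\: S|)%N.
  by rewrite cardsD (setIidPr Sf) fk Sk subSn ?subnn.
rewrite inE => /andP[vS vf]; exists v => //; apply/eqP; rewrite eq_sym eqEcard.
by rewrite subUset sub1set vf Sf cardsU1 vS fk Sk /= add1n.
Qed.

Lemma label_setU1 v S : v \notin S -> label (v |: S) = ((v + \sum_(i in S) i) %% n)%N.
Proof. by move=> vS; rewrite /label big_setU1. Qed.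

Lemma label_proper f g S : f \in K -> g \in K -> S \in faces f -> S \in faces g ->
  label f = label g -> f = g.
Proof.
move=> fK gK Sf Sg; have [v vS ->] := face_ext fK Sf; have [w wS ->] := face_ext gK Sg.
rewrite !label_setU1 // => /eqP; rewrite eqn_modDr !modn_small // => /eqP vw.
by rewrite (ord_inj vw).
Qed.

Lemma label_lt f : f \in K -> (label f < n)%N.
Proof.
rewrite inE => /eqP fk; rewrite ltn_mod.
have /card_gt0P[v _] : (0 < #|f|)%N by rewrite fk.
exact: leq_ltn_trans (ltn_ord v).
Qed.

Lemma face_degree S : S \in P0 -> (n <= #|[set f in K | S \in faces f]| + k)%N.
Proof.
rewrite inE => /eqP Sk; rewrite addnC -leq_subLR.
rewrite (_ : (n - k = #|~: S|)%N); last by rewrite cardsCs setCK card_ord Sk.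
rewrite -(card_in_imset (f := fun v => v |: S)) => [|v w].
  apply: subset_leq_card; apply/subsetP => f /imsetP[v]; rewrite inE => vS ->.
  by rewrite !inE cardsU1 vS Sk add1n subsetUr !eqxx.
rewrite !inE => vS wS eqS; apply/eqP.
by have := setU11 v S; rewrite eqS in_setU1 (negbTE vS) orbF.
Qed.

Lemma greedy_matching (G : {set {set V}}) : (#|greedy K faces label G| <= nu k G)%N.
Proof.
have [_ H] := nuP k G; apply: H; apply/andP; split.
  by apply/subsetP => f; rewrite inE => /andP[/setIP[]].
apply/forall_inP => f fM; apply/forall_inP => g gM; apply/implyP => fg.
rewrite ltnNge; apply/negP => /ksubset_exists[S Sfg Sk].
have /pred0P/(_ S) := greedy_disjoint label_proper fM gM fg.
by move: Sfg; rewrite subsetI /= !inE Sk eqxx => /andP[-> ->].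
Qed.

End CompleteHypergraph.

(** The greedy matching leaves at most a fraction [s^-1 + B * p] of the k-sets
    uncovered.  The constant [B] depends on the bound [C] for [n * p] only. *)
Theorem nu_lower (R : realType) (k : nat) (C : R) : (0 < k)%N -> 0 <= C ->
  exists2 B : R, 0 <= B & forall (n : nat) (p s : R), 0 <= p <= 1 -> n%:R * p <= C ->
    0 < s -> s ^+ k <= 1 + k%:R * (n%:R * p) ->
    ('C(n, k))%:R * (1 - s^-1 - B * p) <=
      k.+1%:R * Ex p (ksets 'I_n k.+1) (fun G => (nu k G)%:R).
Proof.
move=> k0 C0; set r : R := k.+1%:R.
pose X := expR (r * C); have X0 : 0 < X by exact: expR_gt0.
pose kap := 1 + C * r * X * (1 + X).
have r0 : 0 <= r by [].
have kap0 : 0 <= kap by rewrite addr_ge0 // !mulr_ge0 ?addr_ge0 // ltW.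
exists ((k%:R + 2 * r * kap) * X).
  by rewrite mulr_ge0 ?(ltW X0) // addr_ge0 // !mulr_ge0.
move=> n p s p01 npC s0 sk; have [p0 p1] := andP p01.
have A0 : 0 <= 1 + p * r by rewrite addr_ge0 ?mulr_ge0.
have AX : (1 + p * r) ^+ n <= X.
  apply: (@le_trans _ _ (expR (p * r) ^+ n)).
    by rewrite lerXn2r ?nnegrE ?expR_ge0 // expR_ge1Dx.
  by rewrite -expRM_natl ler_expR mulrA [n%:R * p * r]mulrC ler_wpM2l.
have An0 : 0 <= (1 + p * r) ^+ n by rewrite exprn_ge0.
have kapX : overlap_bound k.+1 n p <= kap.
  have H1 : n%:R * (p * r * (1 + p * r) ^+ n) <= C * r * X.
    rewrite [leLHS](_ : _ = n%:R * p * r * (1 + p * r) ^+ n); last by ring.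
    by rewrite ler_pM ?mulr_ge0 // ler_wpM2r.
  rewrite /overlap_bound -/r lerD2l; apply: ler_pM => //; rewrite ?addr_ge0 ?mulr_ge0 //.
  by rewrite lerD2l.
have defX : free_error k.+1 n k p * (1 + p * r) ^+ n <= (k%:R + 2 * r * kap) * X * p.
  rewrite -/r mulrAC ler_pM //; last first.
    rewrite /free_error -/r mulrC; have : r * (p * overlap_bound k.+1 n p) <= r * (p * kap).
      by rewrite !ler_wpM2l.
    by lra.
  by rewrite /free_error addr_ge0 ?mulr_ge0 // ?mulr_ge0 // overlap_bound_ge0.
have uS : free_seq k.+1 p n <= s^-1.
  rewrite leNgt; apply/negP => us.
  have /andP[u0 u1] := @free_seq01 k.+1 R p p01 isT n.
  have := @free_seq_bound k.+1 R p p01 isT n; rewrite /= leNgt => /negP[].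
  rewrite [p * _]mulrC; apply: (@lt_le_trans _ _ (free_seq k.+1 p n ^+ k * s ^+ k)).
    rewrite -exprMn exprn_egt1 -?lt0n //.
    by rewrite -ltr_pdivrMr // div1r.
  by rewrite ler_wpM2l // exprn_ge0.
have := greedy_size (@faces_uniform n k) (@faces_sub n k) (@faces_linear n k)
  (@label_proper n k) (@label_lt n k) (@face_degree n k) p01 isT.
rewrite card_ksets => H; apply: (le_trans _ (le_trans H _)).
  by rewrite ler_wpM2l //; lra.
rewrite ler_wpM2l //; apply: ler_Ex => // G _; rewrite ler_nat.
exact: greedy_matching.
Qed.

(** * Covers from families that meet every edge *)

Lemma exprn_mul1D_le1 (R : realFieldType) (p : R) j : 0 <= p <= 1 ->
  (1 - p) ^+ j * (1 + j%:R * p) <= 1.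
Proof.
move=> /andP[p0 p1]; apply: (@le_trans _ _ ((1 - p) ^+ j * (1 + p) ^+ j)).
  by rewrite ler_wpM2l ?exprn_ge0 ?subr_ge0 // bernoulli_ge //; lra.
by rewrite -exprMn exprn_ile1 //; nra.
Qed.

(** The convex function [a |-> (1 - p) ^ a] lies above this line, which meets it at
    [a = m]; with an integer [m] Bernoulli's inequality is enough. *)
Lemma exprn_tangent (R : realFieldType) (p : R) (a m : nat) : 0 <= p <= 1 ->
  (1 - p) ^+ m * (1 - p * (a%:R - m%:R)) <= (1 - p) ^+ a.
Proof.
move=> p01; have [p0 p1] := andP p01.
have [ma|/ltnW am] := leqP m a.
  rewrite -(subnKC ma) exprD natrD addrAC subrr add0r ler_wpM2l ?exprn_ge0 ?subr_ge0 //.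
  by have := @bernoulli_ge R (- p) (a - m); rewrite mulrN mulrC; apply; lra.
rewrite -[in leLHS](subnKC am) exprD natrD -mulrA ler_piMr ?exprn_ge0 ?subr_ge0 //.
rewrite opprD addrA subrr add0r mulrN opprK mulrC [p * _]mulrC.
by rewrite mulrC exprn_mul1D_le1.
Qed.

Section Allocation.
Variables (R : realType) (n k : nat).
Let V := 'I_n.
Let K := ksets V k.+1.
Implicit Types (D G : {set {set V}}).

Definition covers_all (D : {set {set V}}) : bool := is_cover k K D.

Lemma tau_le_covers_all D G : G \subset K -> covers_all D -> (tau k G <= #|D|)%N.
Proof.
move=> GK /andP[Dk /forall_inP DK].
have [_ ->] := tauP (leqnSn k) GK => //.
by rewrite /is_cover Dk; apply/forall_inP => f /(subsetP GK); exact: DK.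
Qed.

(** Give every (k+1)-set to one member of the family it contains, and keep the
    members that received an edge.  A member given [a] sets is kept with
    probability [1 - (1 - p) ^ a], which is concave in [a]. *)
Lemma tau_alloc D (p kap : R) (m : nat) : 0 <= p <= 1 -> covers_all D ->
  #|D|%:R <= kap * 'C(n, k)%:R -> n%:R <= m%:R * (k.+1%:R * kap) ->
  Ex p K (fun G => (tau k G)%:R) <= kap * 'C(n, k)%:R * (1 - (1 - p) ^+ m).
Proof.
move=> p01 DK Dkap nm; have [p0 p1] := andP p01.
have /andP[Dk /forall_inP Dcov] := DK.
pose asg (f : {set V}) := odflt set0 [pick S in D | S \subset f].
have asgP f : f \in K -> (asg f \in D) && (asg f \subset f).
  move=> /Dcov /exists_inP[S SD Sf]; rewrite /asg; case: pickP => [S' /= //|].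
  by move=> /(_ S); rewrite SD Sf.
pose B S := [set f in K | asg f == S].
have tauB G : G \subset K -> (tau k G <= \sum_(S in D) ~~ [disjoint B S & G])%N.
  move=> GK; have [_ H] := tauP (leqnSn k) GK.
  apply: (leq_trans (H (asg @: G) _)).
    apply/andP; split.
      apply/subsetP => S /imsetP[f /(subsetP GK) /asgP /andP[fD _] ->].
      exact: (subsetP Dk).
    apply/forall_inP => f fG; apply/exists_inP; exists (asg f); first exact: imset_f.
    by have /andP[] := asgP f (subsetP GK f fG).
  rewrite sum_nat_in; apply: subset_leq_card; apply/subsetP => S /imsetP[f fG ->].
  have fK := subsetP GK f fG; rewrite inE; have /andP[-> _] := asgP f fK => /=.
  by apply/pred0Pn; exists f => /=; rewrite fG andbT in_set eqxx andbT.
have sumB : (\sum_(S in D) #|B S| = 'C(n, k.+1))%N.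
  have asgD f : f \in K -> asg f \in D by move=> /asgP /andP[].
  rewrite -card_ksets -sum1_card (partition_big asg (fun S => S \in D) asgD) /=.
  by apply: eq_bigr => S _; rewrite -sum1_card; apply: eq_bigl => f; rewrite !inE.
apply: (@le_trans _ _ (\sum_(S in D) (1 - (1 - p) ^+ #|B S|))).
  have -> : \sum_(S in D) (1 - (1 - p) ^+ #|B S|) =
      Ex p K (fun G => \sum_(S in D) (~~ [disjoint B S & G])%:R).
    rewrite Ex_sum; apply: eq_bigr => S _.
    rewrite -(@Ex_disjoint _ _ _ K); last by apply/subsetP => f; rewrite inE => /andP[].
    rewrite -[X in X - _](Ex_cst p K) -ExB; apply: eq_Ex => G _.
    by case: [disjoint _ & _]; rewrite /= ?subrr ?subr0.
  by apply: ler_Ex => // G GK; rewrite -natr_sum ler_nat tauB.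
set w := (1 - p) ^+ m.
have w0 : 0 <= w by rewrite exprn_ge0 // subr_ge0.
apply: (@le_trans _ _ (\sum_(S in D) ((1 - w * (1 + m%:R * p)) + w * p * #|B S|%:R))).
  apply: ler_sum => S _; have := @exprn_tangent R p #|B S| m p01; rewrite -/w.
  move: (_ ^+ #|B S|) (#|B S|%:R) => x a; move: w {w0} => w; lra.
rewrite big_split /= sumr_const -big_distrr /= -natr_sum sumB -[X in X + _]mulr_natr.
have H1 : 0 <= 1 - w * (1 + m%:R * p) by rewrite subr_ge0 exprn_mul1D_le1.
have L : 'C(n, k.+1)%:R * k.+1%:R <= n%:R * 'C(n, k)%:R :> R.
  by rewrite -!natrM ler_nat mulnC mul_bin_left leq_mul2r leq_subr orbT.
have r0 : 0 < k.+1%:R :> R by rewrite ltr0n.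
have {L}L : 'C(n, k.+1)%:R <= m%:R * (kap * 'C(n, k)%:R).
  rewrite -(ler_pM2r r0) (le_trans L) //.
  apply: (le_trans (ler_wpM2r _ nm)) => //.
  by rewrite le_eqVlt; apply/orP; left; apply/eqP; ring.
apply: (le_trans (lerD (ler_wpM2l H1 Dkap) (ler_wpM2l (mulr_ge0 w0 p0) L))).
by rewrite le_eqVlt; apply/orP; left; apply/eqP; rewrite -/w; ring.
Qed.

End Allocation.

(** * The constructions of Turan and Giraud *)

Section CompleteCovers.
Local Open Scope nat_scope.

Section Resample.
Variables (T Q : finType).

Definition recolour (c : {ffun T -> Q}) x a : {ffun T -> Q} :=
  [ffun y => if y == x then a else c y].

(** Redrawing one coordinate of a uniform function leaves it uniform. *)
Lemma resample (F : {ffun T -> Q} -> nat) (x : T) :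
  #|Q| * (\sum_c F c) = \sum_c \sum_a F (recolour c x a).
Proof.
pose s (X : {ffun T -> Q} * Q) := (recolour X.1 x X.2, X.1 x).
have sK : involutive s.
  move=> [c a]; rewrite /s /=; congr (_, _); last by rewrite ffunE eqxx.
  by apply/ffunP => y; rewrite !ffunE; case: eqP => [->|].
rewrite (pair_bigA _ (fun c a => F (recolour c x a))) /=.
transitivity (\sum_(X : {ffun T -> Q} * Q) F X.1).
  rewrite -(pair_bigA _ (fun c _ => F c)) /= big_distrr /=; apply: eq_bigr => c _.
  by rewrite sum_nat_const.
by rewrite (reindex_inj (inv_inj sK)).
Qed.

End Resample.

(** The first moment method: a bound [a / b] on the probability that each set is
    chosen gives an outcome with at most that proportion of the sets. *)
Lemma exists_le_average (I J : finType) (A : I -> {set J}) (B : {set J}) (a b : nat) :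
  0 < #|I| -> (forall i, A i \subset B) ->
  (forall S, S \in B -> b * (\sum_i (S \in A i)) <= a * #|I|) ->
  exists i, b * #|A i| <= a * #|B|.
Proof.
move=> I0 AB H; apply/existsP; apply: contraT => /existsPn none.
have : \sum_(i : I) a * #|B| < \sum_(i : I) b * #|A i|.
  have [i0 _] := card_gt0P I0.
  rewrite (bigD1 i0) //= [X in _ < X](bigD1 i0) //= -addSn leq_add //.
    by rewrite ltnNge none.
  by apply: leq_sum => i _; rewrite ltnW // ltnNge none.
rewrite ltnNge => /negP[].
have -> : \sum_i b * #|A i| = \sum_(S in B) b * (\sum_i (S \in A i)).
  rewrite -!big_distrr /= exchange_big /=; congr (b * _); apply: eq_bigr => i _.
  rewrite sum_nat_in; apply: eq_card => S; rewrite inE.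
  by case: (boolP (S \in A i)) => [/(subsetP (AB i)) ->|]; rewrite ?andbF.
rewrite sum_nat_const.
apply: (@leq_trans (\sum_(S in B) a * #|I|)); first exact: leq_sum.
by rewrite sum_nat_const mulnCA [X in (_ <= X)%N]mulnCA (mulnC #|B|).
Qed.

Section Turan4.
Variable n : nat.
Let V := 'I_n.
Implicit Types (c : {ffun V -> 'I_3}) (S : {set V}).

Definition colour_count c S i : nat := \sum_(v in S) (c v == i).

Definition next (i : 'I_3) : 'I_3 := ordS i.

(** Turan's construction: a triple without the colour preceding its majority colour *)
Definition turan3 c : {set {set V}} :=
  [set S in ksets V 3 | [exists i,
    (1 < colour_count c S i) && (colour_count c S (next (next i)) == 0)]].

Lemma colour_count_D1 c S v i : v \in S ->
  colour_count c S i = (c v == i) + colour_count c (S :\ v) i.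
Proof. by move=> vS; rewrite /colour_count (big_setD1 v). Qed.

Lemma colour_count_total c S :
  colour_count c S (inord 0) + colour_count c S (inord 1) + colour_count c S (inord 2) = #|S|.
Proof.
rewrite -sum1_card /colour_count -!big_split /=; apply: eq_bigr => v _.
by case: (c v) => [[|[|[|j]]] lj] //; rewrite -!val_eqE /= !inordK.
Qed.

Lemma colour_count_gt0 c S i : 0 < colour_count c S i -> exists2 v, v \in S & c v = i.
Proof.
move=> H; have /exists_inP[v vS /eqP ci] : [exists v in S, c v == i]; last by exists v.
apply: contraTT H => /exists_inPn none; rewrite -leqNgt leqn0; apply/eqP.
by apply: big1 => v /none /negbTE ->.
Qed.

Lemma turan3_cover c : covers_all 3 (turan3 c).
Proof.
apply/andP; split; first by apply/subsetP => S; rewrite inE => /andP[].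
apply/forall_inP => f; rewrite inE => /eqP f4.
suff [i [v [vf Hi Hn]]] : exists i v, [/\ v \in f, 1 < colour_count c (f :\ v) i &
    colour_count c (f :\ v) (next (next i)) = 0].
  apply/exists_inP; exists (f :\ v); last exact: subD1set.
  rewrite !inE; have := cardsD1 v f; rewrite vf f4 add1n => -[<-] /=.
  by apply/existsP; exists i; rewrite Hi Hn eqxx.
have nn : (next (next (inord 0)) = inord 2) * (next (next (inord 1)) = inord 0) *
          (next (next (inord 2)) = inord 1).
  by rewrite /next; do !split; apply: val_inj; rewrite /= !inordK.
have /= tot := colour_count_total c f; rewrite f4 in tot.
(* If two colours occur twice, only one of them has the other as predecessor;
   the vertex removed is the one of the predecessor colour, if there is one. *)
have [i [Hi Hn Hs]] : exists i, [/\ 1 < colour_count c f i, colour_count c f (next (next i)) <= 1 &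
    colour_count c f i + colour_count c f (next i) + colour_count c f (next (next i)) = 4].
  have n1 : (next (inord 0) = inord 1) * (next (inord 1) = inord 2) *
            (next (inord 2) = inord 0).
    by rewrite /next; do !split; apply: val_inj; rewrite /= !inordK.
  have [?|?] := leqP 2 (colour_count c f (inord 0));
  have [?|?] := leqP 2 (colour_count c f (inord 1));
  have [?|?] := leqP 2 (colour_count c f (inord 2)); try lia;
  [exists (inord 0)|exists (inord 2)|exists (inord 0)|exists (inord 1)
  |exists (inord 1)|exists (inord 2)]; rewrite !nn !n1; split; lia.
have [zero|pos] := posnP (colour_count c f (next (next i))); last first.
  have [v vf cv] := colour_count_gt0 pos; exists i, v.
  have := @colour_count_D1 c f v (next (next i)) vf; rewrite cv eqxx.
  have := @colour_count_D1 c f v i vf; rewrite cv.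
  have ni : (next (next i) == i) = false.
    by case: (i) => [[|[|[|j]]] lj] //; rewrite -val_eqE.
  rewrite ni => H1 H2; split => //; first by move: Hi; rewrite H1.
  by move: Hn; rewrite H2 add1n ltnS leqn0 => /eqP.
have [H3|H2] := leqP 3 (colour_count c f i).
  have [|v vf cv] := @colour_count_gt0 c f i; first by lia.
  exists i, v; have := @colour_count_D1 c f v i vf;
    have := @colour_count_D1 c f v (next (next i)) vf.
  rewrite zero cv eqxx => H4 H5; split => //; first by move: H3; rewrite H5 add1n.
  by apply/eqP; move/esym/eqP: H4; rewrite addn_eq0 => /andP[].
have [|v vf cv] := @colour_count_gt0 c f (next i); first by lia.
exists i, v; have := @colour_count_D1 c f v i vf; have := @colour_count_D1 c f v (next (next i)) vf.
have ni : (next i == i) = false.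
  by case: (i) => [[|[|[|j]]] lj] //; rewrite -val_eqE.
rewrite zero cv ni => H4 H5; split => //; first by move: Hi; rewrite H5.
by apply/eqP; move/esym/eqP: H4; rewrite addn_eq0 => /andP[].
Qed.


Lemma cards_consP k S : #|S| = k.+1 ->
  exists2 x, x \notin S :\ x & S = x |: (S :\ x) /\ #|S :\ x| = k.
Proof.
move=> Sk; have /card_gt0P[x xS] : 0 < #|S| by rewrite Sk.
exists x; first by rewrite setD11.
by split; [rewrite setD1K|move: Sk; rewrite (cardsD1 x) xS add1n => -[]].
Qed.

Lemma exists_I3 (F : pred 'I_3) :
  [exists i, F i] = [|| F ord0, F (ordS ord0) | F (ordS (ordS ord0))].
Proof.
apply/existsP/or3P => [[[[|[|[|j]]] lj] Fi] //|[] Fi]; [constructor 1|constructor 2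
  |constructor 3|..]; try (by exists ord0); try (by exists (ordS ord0));
  try (by exists (ordS (ordS ord0))); congr F: Fi; exact: val_inj.
Qed.

(** Of the 27 colourings of a triple, 3 are constant and 9 have two vertices of
    one colour and one of the next. *)
Lemma turan3_average S : S \in ksets V 3 ->
  27 * (\sum_c (S \in turan3 c)) = 12 * #|{ffun V -> 'I_3}|.
Proof.
rewrite inE => /eqP S3.
have [x xS [eS S2]] := cards_consP S3.
have [y yS [eS' S1]] := cards_consP S2.
have [z zS [eS'' S0]] := cards_consP S1.
have S00 := cards0_eq S0.
rewrite S00 setU0 in eS''; rewrite eS'' in eS' yS; rewrite eS' in eS xS.
move: xS yS eS S3; rewrite !inE !negb_or => /andP[xy xz] yz eS S3.
have -> : forall s, 27 * s = 3 * (3 * (3 * s)) by move=> s; lia.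
have R F v : 3 * (\sum_(c : {ffun V -> 'I_3}) F c) = \sum_c \sum_a F (recolour c v a).
  by rewrite -resample card_ord.
rewrite (R _ z) (R _ y) (R _ x) mulnC -sum_nat_const; apply: eq_bigr => c _.
pose P (a b d i : 'I_3) := (1 < (a == i) + ((b == i) + (d == i))) &&
  ((a == next (next i)) + ((b == next (next i)) + (d == next (next i))) == 0).
transitivity (\sum_a \sum_b \sum_d
    [|| P a b d ord0, P a b d (ordS ord0) | P a b d (ordS (ordS ord0))] : nat).
  apply: eq_bigr => a _; apply: eq_bigr => b _; apply: eq_bigr => d _; congr nat_of_bool.
  rewrite inE -exists_I3 inE S3 /=; apply: eq_existsb => i.
  have C j : colour_count (recolour (recolour (recolour c x a) y b) z d) S j =
      (a == j) + ((b == j) + (d == j)).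
    rewrite eS /colour_count big_setU1 ?inE ?negb_or ?xy //=.
    rewrite big_setU1 ?inE //= big_set1 !ffunE !eqxx.
    by rewrite (negbTE xz) (negbTE xy) (negbTE yz).
  by rewrite !C.
by rewrite !big_ord_recl !big_ord0.
Qed.

(** [4/9] is the density of Turan's construction. *)
Lemma turan3_exists : exists2 D : {set {set V}}, covers_all 3 D & 9 * #|D| <= 4 * 'C(n, 3).
Proof.
have [|c|S SK|c Hc] := @exists_le_average _ _ turan3 (ksets V 3) 4 9.
- by apply/card_gt0P; exists [ffun=> ord0].
- by apply/subsetP => S; rewrite inE => /andP[].
- by rewrite -(leq_pmul2l (isT : 0 < 3)) !mulnA turan3_average.
by exists (turan3 c); [exact: turan3_cover|rewrite -card_ksets].
Qed.

End Turan4.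

Section Turan5.
Variable n : nat.
Let V := 'I_n.
Implicit Types (c : {ffun V -> bool}) (e : {ffun V * V -> bool}) (S : {set V}).

Definition rows c S : nat := \sum_(v in S) c v.

Definition minus_at c e S (X : V * V) : bool :=
  [&& X.1 \in S, X.2 \in S, c X.1, ~~ c X.2 & e X].

Definition minuses c e S : nat := \sum_X minus_at c e S X.

(** Giraud's construction: the vertices are the rows and the columns of a
    matrix of signs, [e] marking the minus signs; take the quadruples of rows,
    the quadruples of columns, and the 2 by 2 minors with product of signs +. *)
Definition giraud c e : {set {set V}} :=
  [set S in ksets V 4 | [|| rows c S == 0, rows c S == 4 |
                            (rows c S == 2) && ~~ odd (minuses c e S)]].

Lemma rows_D1 c S v : v \in S -> rows c S = c v + rows c (S :\ v).
Proof. by move=> vS; rewrite /rows (big_setD1 v). Qed.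

Lemma sum_odd (A : pred V) (F : V -> nat) : (forall v, A v -> odd (F v)) ->
  odd (\sum_(v | A v) F v) = odd (\sum_(v | A v) 1).
Proof.
move=> oF; rewrite (eq_bigr (fun v => 1 + (F v)./2.*2)) => [|v /oF oFv]; last first.
  by rewrite -{1}[F v]odd_double_half oFv.
rewrite big_split /= oddD (_ : \sum_(v | A v) (F v)./2.*2 = (\sum_(v | A v) (F v)./2).*2).
  by rewrite odd_double addbF.
by rewrite -mul2n big_distrr /=; apply: eq_bigr => v _; rewrite mul2n.
Qed.

(** In a 3 by 2 or 2 by 3 array of signs each entry lies in two of the three 2 by 2
    minors, so an even number of the minors has product -, hence not all three. *)
Lemma even_minor c e S (b : bool) : \sum_(v in S) (c v == b) = 3 ->
  exists v, [/\ v \in S, c v = b & ~~ odd (minuses c e (S :\ v))].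
Proof.
move=> S3; suff /exists_inP[v vS /andP[/eqP cv ov]] :
    [exists v in S, (c v == b) && ~~ odd (minuses c e (S :\ v))] by exists v.
apply: contraT => /exists_inPn none.
have : odd (\sum_(v | (v \in S) && (c v == b)) minuses c e (S :\ v)).
  rewrite sum_odd => [|v /andP[vS cv]].
    by rewrite big_mkcondr (eq_bigr (fun v => (c v == b) : nat)) ?S3.
  by have := none v vS; rewrite cv negbK.
rewrite /minuses exchange_big /=.
rewrite (eq_bigr (fun X => 2 * minus_at c e S X)) => [|X _].
  by rewrite -big_distrr /= oddM.
pose w := if b then X.1 else X.2.
case: (boolP (minus_at c e S X)) => [|noX]; last first.
  rewrite big1 // => v /andP[vS cv]; apply/eqP; rewrite eqb0; apply: contra noX.
  by rewrite /minus_at !in_setD1 => /and5P[/andP[_ ->] /andP[_ ->] -> -> ->].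
move=> /and5P[X1 X2 c1 c2 eX].
have cw : c w == b by rewrite /w; case: (b); rewrite ?c1 // (negbTE c2).
have wS : w \in S by rewrite /w; case: (b).
have := S3; rewrite (big_setD1 w) //= cw add1n => -[<-].
rewrite (bigD1 w) /= ?wS //.
have -> : minus_at c e (S :\ w) X = false.
  by rewrite /minus_at !in_setD1 /w; case: (b); rewrite eqxx ?andbF.
rewrite add0n muln1 [RHS]big_mkcond /= big_mkcond /=; apply: eq_bigr => v _.
rewrite in_setD1; have [->|vw] := eqVneq v w; first by rewrite !andbF.
rewrite andbT /=; case: (boolP (v \in S)) => //= vS; case: eqP => //= cv.
rewrite /minus_at !in_setD1 X1 X2 c1 c2 eX !andbT.
suff -> : (X.1 != v) && (X.2 != v) by [].
move: vw cv; rewrite /w eq_sym; case: (b) => vw cv; rewrite vw ?andbT /=.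
  by apply: contraNneq c2 => ->; rewrite cv.
by apply: contraTneq c1 => ->; rewrite cv.
Qed.

Lemma giraud_cover c e : covers_all 4 (giraud c e).
Proof.
apply/andP; split; first by apply/subsetP => S; rewrite inE => /andP[].
apply/forall_inP => f; rewrite inE => /eqP f5.
suff [v vf Hv] : exists2 v, v \in f & [|| rows c (f :\ v) == 0, rows c (f :\ v) == 4 |
                            (rows c (f :\ v) == 2) && ~~ odd (minuses c e (f :\ v))].
  apply/exists_inP; exists (f :\ v); last exact: subD1set.
  by rewrite !inE Hv andbT; have := cardsD1 v f; rewrite vf f5 add1n => -[<-].
have colsE : \sum_(v in f) (c v == false) + rows c f = 5.
  rewrite -f5 -sum1_card /rows -big_split /=; apply: eq_bigr => v _; by case: (c v).
have colsN : \sum_(v in f) (c v == false) = 5 - rows c f by rewrite -colsE addnK.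
have rowsE : \sum_(v in f) (c v == true) = rows c f.
  by apply: eq_bigr => v _; case: (c v).
have pick_v b : 0 < \sum_(v in f) (c v == b) -> exists2 v, v \in f & c v = b.
  move=> H; suff /exists_inP[v vf /eqP cv] : [exists v in f, c v == b] by exists v.
  apply: contraTT H => /exists_inPn none; rewrite -leqNgt leqn0; apply/eqP.
  by apply: big1 => v /none /negbTE ->.
case E : (rows c f) => [|[|[|[|[|[|k]]]]]]; last by
  have := leq_addl (\sum_(v in f) (c v == false)) (rows c f); rewrite colsE E.
- have [|v vf cv] := pick_v false; first by rewrite colsN E.
  by exists v => //; have := rows_D1 c vf; rewrite E cv add0n => <-.
- have [|v vf cv] := pick_v true; first by rewrite rowsE E.
  by exists v => //; have := rows_D1 c vf; rewrite E cv add1n => -[<-].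
- have [|v [vf cv ov]] := @even_minor c e f false; first by rewrite colsN E.
  by exists v => //; have := rows_D1 c vf; rewrite E cv add0n ov => <-.
- have [|v [vf cv ov]] := @even_minor c e f true; first by rewrite rowsE.
  by exists v => //; have := rows_D1 c vf; rewrite E cv add1n ov => -[<-].
- have [|v vf cv] := pick_v false; first by rewrite colsN E.
  by exists v => //; have := rows_D1 c vf; rewrite E cv add0n => <-.
- have [|v vf cv] := pick_v true; first by rewrite rowsE E.
  by exists v => //; have := rows_D1 c vf; rewrite E cv add1n => -[<-].
Qed.

(** Redrawing the sign at a single entry of the minor makes the parity uniform. *)
Lemma even_minuses_half c S : rows c S = 2 -> #|S| = 4 ->
  2 * (\sum_e ~~ odd (minuses c e S)) = #|{ffun V * V -> bool}|.
Proof.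
move=> S2 S4.
have /exists_inP[u uS cu] : [exists v in S, c v].
  apply: contraTT (introT eqP S2) => /exists_inPn none.
  by rewrite /rows big1 // => v /none /negbTE ->.
have /exists_inP[w wS cw] : [exists v in S, ~~ c v].
  apply: contraT => /exists_inPn none.
  move: S2; rewrite /rows (eq_bigr (fun=> 1)) ?sum1_card ?S4 // => v /none.
  by rewrite negbK => ->.
rewrite -[X in X * _]card_bool (resample _ (u, w)) -sum1_card; apply: eq_bigr => e _.
pose rest := \sum_(X | X != (u, w)) minus_at c e S X.
have E b : minuses c (recolour e (u, w) b) S = b + rest.
  rewrite /minuses (bigD1 (u, w)) //=; congr (_ + _).
    by rewrite /minus_at /= uS wS cu cw ffunE eqxx.
  by apply: eq_bigr => X Xuw; rewrite /minus_at ffunE (negbTE Xuw).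
by rewrite big_bool /= !E !oddD; case: (odd rest).
Qed.


Lemma giraud_fibre c S : S \in ksets V 4 ->
  2 * (\sum_e (S \in giraud c e)) =
  (2 * ((rows c S == 0) || (rows c S == 4)) + (rows c S == 2)) * #|{ffun V * V -> bool}|.
Proof.
move=> SK; have S4 : #|S| = 4 by move: SK; rewrite inE => /eqP.
rewrite (eq_bigr (fun e => [|| rows c S == 0, rows c S == 4 |
   (rows c S == 2) && ~~ odd (minuses c e S)] : nat)) => [|e _]; last by rewrite inE SK.
have [H|] := boolP ((rows c S == 0) || (rows c S == 4)).
  rewrite (_ : (rows c S == 2) = false); last by case/orP: H => /eqP ->.
  by rewrite addn0 muln1 (eq_bigr (fun=> 1)) ?sum1_card // => e _; rewrite orbA H.
rewrite negb_or => /andP[/negbTE H0 /negbTE H4]; rewrite H0 H4 /=.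
case: (rows c S =P 2) => [S2|_] /=.
  by rewrite even_minuses_half // muln0 add0n mul1n.
by rewrite big1.
Qed.

(** Of the 16 ways to split a quadruple into rows and columns, 2 are trivial and 6
    are balanced; the latter count for one half: (2 + 6 / 2) / 16 = 5 / 16. *)
Lemma giraud_average S : S \in ksets V 4 ->
  32 * (\sum_c \sum_e (S \in giraud c e)) =
  10 * #|{: {ffun V -> bool} * {ffun V * V -> bool}}|.
Proof.
move=> SK; have S4 : #|S| = 4 by move: SK; rewrite inE => /eqP.
rewrite -[32]/(16 * 2) -mulnA big_distrr /= (eq_bigr _ (fun c _ => giraud_fibre c SK)).
rewrite -big_distrl /= card_prod !mulnA; congr (_ * _).
have [x xS [eS S3]] := cards_consP S4.
have [y yS [eS' S2]] := cards_consP S3.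
have [z zS [eS'' S1]] := cards_consP S2.
have [t tS [eS''' S0]] := cards_consP S1.
have S00 := cards0_eq S0.
rewrite S00 setU0 in eS'''; rewrite eS''' in eS'' zS; rewrite eS'' in eS' yS.
rewrite eS' in eS xS.
move: xS yS zS; rewrite !inE !negb_or => /and3P[xy xz xt] /andP[yz yt] zt.
have -> : forall s, 16 * s = 2 * (2 * (2 * (2 * s))) by move=> s; lia.
have R F v : 2 * (\sum_(c : {ffun V -> bool}) F c) = \sum_c \sum_a F (recolour c v a).
  by rewrite -resample card_bool.
rewrite (R _ t) (R _ z) (R _ y) (R _ x) mulnC -sum_nat_const; apply: eq_bigr => c _.
have C a b d g : rows (recolour (recolour (recolour (recolour c x a) y b) z d) t g) S =
    a + (b + (d + g)).
  rewrite eS /rows big_setU1 ?inE ?negb_or ?xy ?xz //= big_setU1 ?inE ?negb_or ?yz //=.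
  rewrite big_setU1 ?inE //= big_set1 !ffunE !eqxx.
  by rewrite (negbTE xt) (negbTE xz) (negbTE xy) (negbTE yt) (negbTE yz) (negbTE zt).
transitivity (\sum_(a : bool) \sum_(b : bool) \sum_(d : bool) \sum_(g : bool)
   (2 * ((a + (b + (d + g)) == 0) || (a + (b + (d + g)) == 4)) + (a + (b + (d + g)) == 2))).
  apply: eq_bigr => a _; apply: eq_bigr => b _; apply: eq_bigr => d _.
  by apply: eq_bigr => g _; rewrite C.
by rewrite !big_bool.
Qed.

(** [5/16] is the density of Giraud's construction. *)
Lemma giraud_exists : exists2 D : {set {set V}}, covers_all 4 D & 16 * #|D| <= 5 * 'C(n, 4).
Proof.
have [|[c e]|S SK|[c e] Hce] :=
  @exists_le_average _ _ (fun X => giraud X.1 X.2) (ksets V 4) 5 16.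
- by apply/card_gt0P; exists ([ffun=> true], [ffun=> true]).
- by apply/subsetP => S; rewrite inE => /andP[].
- rewrite -(leq_pmul2l (isT : 0 < 2)) !mulnA -[2 * 5]/10 -(giraud_average SK).
  by rewrite -(pair_bigA _ (fun c e => (S \in giraud c e) : nat)).
by exists (giraud c e); [exact: giraud_cover|rewrite -card_ksets].
Qed.

End Turan5.

End CompleteCovers.

(** * Covers of triple systems from two halves *)

Section Halves.
Variables (R : realType) (n : nat).
Let V := 'I_n.
Let K := ksets V 3.
Implicit Types (f g S : {set V}) (G : {set {set V}}).

(** A set of vertices is [mono] when it lies in one of the two halves.  For a pair
    [S] inside a half, the sets in [forcing S] have their third vertex in the other
    half, and so contain no monochromatic pair but [S]. *)
Definition half : {set V} := [set v : V | (v < n./2)%N].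

Definition mono S := (S \subset half) || (S \subset ~: half).

Definition other S : {set V} := if S \subset half then ~: half else half.

Definition forcing S : {set {set V}} := [set f in K | (S \subset f) && ~~ mono f].

Definition mono2 := [set S in ksets V 2 | mono S].
Definition mono3 := [set f in K | mono f].

Lemma card_half : #|half| = n./2.
Proof.
have le : (n./2 <= n)%N by rewrite -{2}(odd_double_half n) -addnn addnA leq_addl.
rewrite -[RHS]card_ord -(card_imset (f := widen_ord le)) => [|i j /(congr1 val) /= /ord_inj //].
apply: eq_card => v.
rewrite inE; apply/idP/imsetP => [vn|[w _ ->] /=]; last exact: ltn_ord.
by exists (Ordinal vn) => //; apply: val_inj.
Qed.

Lemma card_halfC : #|~: half| = uphalf n.
Proof.
rewrite cardsCs setCK card_half card_ord uphalf_half.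
by rewrite -{1}(odd_double_half n) -addnn addnA addnK.
Qed.

Lemma card_ksubsets (A : {set V}) k : #|[set S in ksets V k | S \subset A]| = 'C(#|A|, k).
Proof.
by rewrite -cards_draws; apply: eq_card => S; rewrite !inE andbC.
Qed.

Lemma card_mono k : (#|[set S in ksets V k | mono S]| <= 'C(n./2, k) + 'C(uphalf n, k))%N.
Proof.
rewrite -card_half -card_halfC -!card_ksubsets.
apply: leq_trans (leq_card_setU _ _); apply: subset_leq_card; apply/subsetP => S.
by rewrite !inE andb_orr.
Qed.

Lemma other_notin S v : mono S -> v \in other S -> v \notin S.
Proof.
rewrite /mono /other; case: ifP => [sS _|_ /= sS].
  by rewrite inE; apply: contra; exact: (subsetP sS).
by move=> vh; apply/negP => /(subsetP sS); rewrite inE vh.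
Qed.

Lemma mono_setU1 S v : S != set0 -> mono S -> v \notin S -> mono (v |: S) = (v \notin other S).
Proof.
move=> /set0Pn[x xS]; rewrite /mono /other !subUset !sub1set.
case: ifP => [sS _|nS /= ->] vS.
  have -> : (S \subset ~: half) = false.
    by apply/negbTE/negP => /subsetP/(_ x xS); rewrite in_setC (subsetP sS).
  by rewrite andbF orbF andbT in_setC negbK.
by rewrite andbF andbT in_setC.
Qed.

Lemma card_forcing S : S \in mono2 -> #|forcing S| = #|other S|.
Proof.
rewrite !inE => /andP[/eqP S2 mS].
have S0 : S != set0 by rewrite -cards_eq0 S2.
rewrite -(card_in_imset (f := fun v => v |: S)) => [|v w vo wo eqS]; last first.
  have := setU11 v S; rewrite eqS in_setU1 (negbTE (other_notin mS vo)) orbF.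
  by move/eqP.
apply: eq_card => f; rewrite !inE; apply/idP/imsetP => [/and3P[f3 Sf nf]|[v vo ->]].
  have fK : f \in ksets V 3 by rewrite inE.
  have [|v vS ef] := @face_ext n 2 f S fK; first by rewrite !inE Sf S2.
  exists v => //; rewrite ef in nf.
  by move: nf; rewrite mono_setU1 // negbK.
have vS := other_notin mS vo.
by rewrite cardsU1 vS S2 subsetUr mono_setU1 // negbK.
Qed.

Lemma card_other S : (n./2 <= #|other S| <= uphalf n)%N.
Proof.
rewrite /other; case: ifP => _; rewrite ?card_half ?card_halfC leqnn /= ?andbT;
  by rewrite uphalf_half leq_addl.
Qed.

Lemma mono_pair f : f \in K -> exists2 S, S \in mono2 & S \subset f.
Proof.
rewrite inE => /eqP f3.
have [A mA A2] : exists2 A : {set V}, mono (f :&: A) & (2 <= #|f :&: A|)%N.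
  have [h2|h2] := leqP 2 #|f :&: half|.
    by exists half; rewrite // /mono subsetIr.
  exists (~: half); first by rewrite /mono subsetIr orbT.
  rewrite -(leq_add2l 1); apply: (@leq_trans (#|f :&: half| + #|f :&: ~: half|)).
    by rewrite -setDE cardsID f3.
  by rewrite leq_add2r -ltnS.
have [S SA S2] := ksubset_exists A2; exists S; last exact: subset_trans SA (subsetIl _ _).
rewrite !inE S2 eqxx /=; move: mA; rewrite /mono.
by case/orP => h; rewrite (subset_trans SA h) ?orbT.
Qed.

Lemma mono2_cover : covers_all 2 mono2.
Proof.
apply/andP; split; first by apply/subsetP => S; rewrite inE => /andP[].
by apply/forall_inP => f fK; apply/exists_inP; have [S] := mono_pair fK; exists S.
Qed.

Definition forcing3 f : {set {set V}} := \bigcup_(S in faces 2 f) forcing S.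

Lemma mono_sub S f : S \subset f -> mono f -> mono S.
Proof. by move=> Sf /orP[] h; apply/orP; [left|right]; exact: subset_trans h. Qed.

(** An edge across the halves contains only one pair inside a half, so the sets
    forcing the three pairs of [f] are disjoint. *)
Lemma card_forcing3 f : f \in mono3 -> (3 * n./2 <= #|forcing3 f|)%N.
Proof.
rewrite !inE => /andP[/eqP f3 mf].
have fK : f \in ksets V 3 by rewrite inE f3.
have mS S : S \in faces 2 f -> S \in mono2.
  by rewrite !inE => /andP[Sf ->] /=; exact: mono_sub mf.
have faces3 := faces_uniform fK.
apply: (@leq_trans (\sum_(S in faces 2 f) #|forcing S|)).
  rewrite -faces3 -sum_nat_const; apply: leq_sum => S Sf.
  by rewrite card_forcing ?mS //; have /andP[] := card_other S.
rewrite (eq_bigr (fun S => \sum_(g in forcing3 f) (g \in forcing S))%N) => [|S Sf].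
  rewrite exchange_big /= -sum1_card; apply: leq_sum => g.
  case/bigcupP => S0 S0f; rewrite inE => /and3P[gK S0g ng].
  have fg : f != g by apply: contraNneq ng => <-.
  apply: leq_trans (faces_linear fK gK fg); rewrite sum_nat_in.
  apply: subset_leq_card; apply/subsetP => S; rewrite !inE => /andP[/andP[-> ->]].
  by move=> /and3P[_ -> _].
rewrite sum_nat_in; apply: eq_card => g; rewrite inE; apply/idP/andP => [gS|[] //].
by split => //; apply/bigcupP; exists S.
Qed.

(** Cover the pairs inside a half that lie in an edge with a vertex on the
    other side, and one pair of each edge inside a half none of whose pairs is
    covered already. *)
Lemma tau_halves (p : R) : 0 <= p <= 1 ->
  Ex p K (fun G => (tau 2 G)%:R) <=
    ('C(n./2, 2) + 'C(uphalf n, 2))%:R * (1 - (1 - p) ^+ uphalf n) +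
    ('C(n./2, 3) + 'C(uphalf n, 3))%:R * (p * (1 - p) ^+ (3 * n./2)).
Proof.
move=> p01; have [p0 p1] := andP p01.
pose sel f : {set V} := odflt set0 [pick S in faces 2 f].
have selP f : f \in K -> sel f \in faces 2 f.
  move=> fK; rewrite /sel; case: pickP => //= none.
  by have := faces_uniform fK; rewrite (eq_card0 none).
pose C G := [set S in mono2 | ~~ [disjoint forcing S & G]] :|:
            sel @: [set f in mono3 | (f \in G) && [disjoint forcing3 f & G]].
have Ccov G : G \subset K -> is_cover 2 G (C G).
  move=> GK; apply/andP; split.
    apply/subsetP => S /setUP[|/imsetP[f]]; rewrite !inE; first by case/andP => /andP[].
    move=> /andP[/andP[f3 _] _ ->]; have fK : f \in K by rewrite inE.
    by have := selP f fK; rewrite inE => /andP[].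
  apply/forall_inP => f fG; have fK := subsetP GK f fG.
  have f3 : #|f| = 3%N by move: fK; rewrite inE => /eqP.
  have forced S : S \in mono2 -> f \in forcing S -> exists2 S', S' \in C G & S' \subset f.
    move=> Sm fS; exists S; last by move: fS; rewrite inE => /and3P[].
    by rewrite in_setU inE Sm; apply/orP; left; apply/pred0Pn; exists f; apply/andP.
  apply/exists_inP; have [mf|nf] := boolP (mono f).
    have fm : f \in mono3 by rewrite inE fK.
    have [dis|] := boolP [disjoint forcing3 f & G].
      exists (sel f); last by have := selP f fK; rewrite inE => /andP[].
      by rewrite in_setU; apply/orP; right; apply: imset_f; rewrite inE fm fG dis.
    case/pred0Pn => g /andP[/= /bigcupP[S Sf gS] gG]; exists S; last first.
      by move: Sf; rewrite inE => /andP[].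
    rewrite in_setU; apply/orP; left; rewrite !inE; move: Sf; rewrite inE => /andP[Sf ->] /=.
    by rewrite (mono_sub Sf mf); apply/pred0Pn; exists g; apply/andP.
  have [S Sm Sf] := mono_pair fK.
  by apply: (forced S Sm); rewrite inE fK Sf nf.
have tauC G : G \subset K -> (tau 2 G <= \sum_(S in mono2) ~~ [disjoint forcing S & G] +
    \sum_(f in mono3) ((f \in G) && [disjoint forcing3 f & G]))%N.
  move=> GK; have [_ H] := tauP (isT : (2 <= 3)%N) GK.
  apply: (leq_trans (H _ (Ccov G GK))).
  apply: (leq_trans (leq_card_setU _ _)); rewrite !sum_nat_in leq_add2l.
  exact: leq_imset_card.
apply: (@le_trans _ _ (\sum_(S in mono2) (1 - (1 - p) ^+ #|forcing S|) +
    \sum_(f in mono3) p * (1 - p) ^+ #|forcing3 f|)).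
  have forcingK S : forcing S \subset K by apply/subsetP => f; rewrite inE => /andP[].
  have -> : \sum_(S in mono2) (1 - (1 - p) ^+ #|forcing S|) =
      Ex p K (fun G => \sum_(S in mono2) (~~ [disjoint forcing S & G])%:R).
    rewrite Ex_sum; apply: eq_bigr => S _; rewrite -(Ex_disjoint p (forcingK S)).
    rewrite -[X in X - _](Ex_cst p K) -ExB; apply: eq_Ex => G _.
    by case: [disjoint _ & _]; rewrite /= ?subrr ?subr0.
  have -> : \sum_(f in mono3) p * (1 - p) ^+ #|forcing3 f| =
      Ex p K (fun G => \sum_(f in mono3) ((f \in G) && [disjoint forcing3 f & G])%:R).
    rewrite Ex_sum; apply: eq_bigr => f; rewrite inE => /andP[fK mf].
    rewrite -(@Ex_disjoint _ _ p K); last by apply/bigcupsP.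
    rewrite -(@Ex_mem _ _ _ _ _ f) //.
      by apply: eq_Ex => G _; rewrite -natrM mulnb.
    move=> G; congr (nat_of_bool _)%:R; apply/pred0P/pred0P => H g; have /= := H g;
      have [->|gf] := eqVneq g f; rewrite !inE ?eqxx ?(negbTE gf) //=;
      by move=> _; apply/negbTE; rewrite negb_and; apply/orP; left; apply/negP => /bigcupP[S _];
         rewrite inE mf !andbF.
  rewrite -ExD; apply: ler_Ex => // G GK; rewrite -!natr_sum -natrD ler_nat.
  exact: tauC.
have q0 : 0 <= 1 - p by rewrite subr_ge0.
have q1 : 1 - p <= 1 by rewrite gerBl.
apply: lerD.
  apply: (@le_trans _ _ (\sum_(S in mono2) (1 - (1 - p) ^+ uphalf n))).
    apply: ler_sum => S Sm; rewrite lerB // card_forcing //.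
    by apply: ler_wiXn2l => //; have /andP[] := card_other S.
  rewrite sumr_const -[leLHS]mulr_natl ler_wpM2r ?ler_nat ?card_mono //.
  by rewrite subr_ge0 exprn_ile1.
apply: (@le_trans _ _ (\sum_(f in mono3) p * (1 - p) ^+ (3 * n./2))).
  apply: ler_sum => f fm; rewrite ler_wpM2l //; apply: ler_wiXn2l => //.
  exact: card_forcing3.
by rewrite sumr_const -[leLHS]mulr_natl ler_wpM2r ?ler_nat ?card_mono // mulr_ge0 ?exprn_ge0.
Qed.

End Halves.

(** * Comparing the two means *)

Section Numerics.
Variable R : realType.
Implicit Types (c p s a x : R) (n k m j : nat).

Lemma nat_above x : exists n, x <= n%:R.
Proof.
exists (Num.bound `|x|); rewrite (le_trans (ler_norm x)) // ltW //.
by rewrite archi_boundP.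
Qed.

Lemma small_p c (eta : R) : 0 < eta -> exists n1 : nat, forall (n : nat) p, (n1 <= n)%N ->
  n%:R * p <= c -> p <= eta.
Proof.
move=> eta0; have [n1 Hn1] := nat_above (c / eta); exists n1.+1 => n p n1n npc.
have n0 : 0 < n%:R :> R by rewrite ltr0n (leq_trans _ n1n).
rewrite -(ler_pM2l n0) (le_trans npc) // -ler_pdivrMr // (le_trans Hn1) //.
by rewrite ler_nat ltnW.
Qed.

(** Turns an error in the base into an error of the same order in the power. *)
Lemma expr_lipschitz (w x : R) j : 0 <= w -> w <= x -> x <= 1 ->
  x ^+ j - j%:R * (x - w) <= w ^+ j.
Proof.
move=> w0 wx x1; elim: j => [|j IH]; first by rewrite !expr0 mul0r subr0.
rewrite !exprS -natr1.
have xj : 0 <= x ^+ j <= 1 by rewrite exprn_ge0 ?exprn_ile1 // (le_trans w0).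
have [xj0 xj1] := andP xj.
have : w * (x ^+ j - j%:R * (x - w)) <= w * w ^+ j by rewrite ler_wpM2l.
have : 0 <= (1 - x ^+ j) * (x - w) by rewrite mulr_ge0 ?subr_ge0.
have : 0 <= (1 - w) * (j%:R * (x - w)).
  by rewrite mulr_ge0 ?mulr_ge0 ?subr_ge0 // (le_trans wx).
by move: (x ^+ j) (w ^+ j) (j%:R : R) => X W J; lra.
Qed.

(** A polynomial lower bound for [exp (- theta * c)], in the limit the value of
    [(1 - p) ^ (theta * n)] at [n * p = c]: the exponent is split into [j] equal
    parts and Bernoulli's inequality is applied to each. *)
Lemma pow_lower (theta c : R) j (del : R) : (0 < j)%N -> 0 <= theta -> 0 <= c ->
  theta * c <= j%:R -> 0 < del ->
  exists n1 : nat, forall n p m, (n1 <= n)%N -> 0 <= p <= 1 -> n%:R * p <= c ->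
    m%:R <= theta * n%:R + 1 -> (1 - theta * c / j%:R) ^+ j - del <= (1 - p) ^+ m.
Proof.
move=> j0 th0 c0 tcj del0.
have jp : 0 < j%:R :> R by rewrite ltr0n.
have [|n1 H1] := @small_p c (del / (2 * j%:R)); first by rewrite divr_gt0 // mulr_gt0.
exists n1 => n p m n1n p01 npc mn; have [p0 p1] := andP p01.
have {H1}ps := H1 n p n1n npc.
set x := 1 - _; have x01 : 0 <= x <= 1.
  by rewrite subr_ge0 ler_pdivrMr // mul1r tcj gerBl divr_ge0 ?mulr_ge0 // ltW.
have [x0 x1] := andP x01.
have q01 : 0 <= 1 - p <= 1 by rewrite subr_ge0 p1 gerBl.
have [q0 q1] := andP q01.
have jd : j%:R * (2 * p) <= del.
  by move: ps; rewrite ler_pdivlMr ?mulr_gt0 //; lra.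
have [xp|px] := leP x (2 * p).
  rewrite (@le_trans _ _ 0) ?exprn_ge0 // subr_le0.
  apply: (@le_trans _ _ x); first by rewrite -(prednK j0) exprS ler_piMr // exprn_ile1.
  apply: (le_trans xp); apply: le_trans jd.
  by rewrite ler_peMl ?mulr_ge0 // ler1n.
pose t := (m %/ j).+1.
have mt : (m <= t * j)%N by rewrite ltnW // ltn_ceil.
apply: (@le_trans _ _ ((1 - p) ^+ (t * j))); last by rewrite ler_wiXn2l.
have tb : t%:R * j%:R <= m%:R + j%:R :> R.
  by rewrite -natrM -natrD ler_nat /t mulSn addnC leq_add2r leq_trunc_div.
have tp : 1 - t%:R * p >= x - 2 * p.
  rewrite /x -(ler_pM2r jp).
  have -> : (1 - theta * c / j%:R - 2 * p) * j%:R = j%:R - theta * c - 2 * p * j%:R.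
    by field; rewrite pnatr_eq0 -lt0n.
  have : t%:R * j%:R * p <= (theta * n%:R + 1 + j%:R) * p.
    by rewrite ler_wpM2r // (le_trans tb) // lerD2r.
  have : theta * (n%:R * p) <= theta * c by rewrite ler_wpM2l.
  have : p <= j%:R * p by rewrite ler_peMl // ler1n.
  by lra.
have w0 : 0 <= x - 2 * p by rewrite subr_ge0 ltW.
rewrite exprM; apply: (@le_trans _ _ ((x - 2 * p) ^+ j)).
  apply: le_trans (expr_lipschitz j w0 _ x1); last by rewrite gerBl mulr_ge0.
  by rewrite lerD2l lerN2 opprB addrCA subrr addr0.
rewrite lerXn2r ?nnegrE ?exprn_ge0 // (le_trans tp) //.
by have := @bernoulli_ge R (- p) t; rewrite mulrN; apply; lra.
Qed.

Definition Enu k n p : R := Ex p (ksets 'I_n k.+1) (fun G => (nu k G)%:R).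
Definition Etau k n p : R := Ex p (ksets 'I_n k.+1) (fun G => (tau k G)%:R).

Definition tau_bound k c a : Prop :=
  forall del : R, 0 < del -> exists n1 : nat, forall n p, (n1 <= n)%N -> 0 <= p <= 1 ->
    n%:R * p <= c -> Etau k n p <= (a + del) * 'C(n, k)%:R.

(** [n * p * 'C(n, k)] is, up to a constant factor and for large [n], the expected
    number of edges. *)
Definition gap k m c : Prop :=
  exists2 eps : R, 0 < eps & exists n0 : nat, forall n p, (n0 <= n)%N -> 0 <= p <= 1 ->
    n%:R * p <= c -> eps * (n%:R * p) * 'C(n, k)%:R <= m%:R * Enu k n p - Etau k n p.

Lemma binS_le n k : k.+1%:R * 'C(n, k.+1)%:R <= n%:R * 'C(n, k)%:R :> R.
Proof. by rewrite -!natrM ler_nat mul_bin_left leq_mul2r leq_subr orbT. Qed.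

Lemma Ex_card (T : finType) (K : {set T}) p : Ex p K (fun G => #|G|%:R) = p * #|K|%:R.
Proof.
transitivity (Ex p K (fun G => \sum_(f in K) (f \in G)%:R * 1)).
  apply: eq_Ex => G GK; under eq_bigr do rewrite mulr1.
  rewrite -natr_sum sum_nat_in; congr _%:R; apply: eq_card => f; rewrite inE.
  by case: (boolP (f \in G)) => [/(subsetP GK) ->|]; rewrite ?andbF.
rewrite Ex_sum (eq_bigr (fun=> p)) => [|f fK]; first by rewrite sumr_const mulr_natr.
by rewrite Ex_mem // Ex_cst mulr1.
Qed.

Lemma Etau_le_edges k n p : 0 <= p <= 1 ->
  k.+1%:R * Etau k n p <= n%:R * p * 'C(n, k)%:R.
Proof.
move=> p01; have [p0 p1] := andP p01.
apply: (@le_trans _ _ (k.+1%:R * (p * 'C(n, k.+1)%:R))).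
  rewrite ler_wpM2l // -card_ksets -Ex_card; apply: ler_Ex => // G GK.
  by rewrite ler_nat; apply: (@tau_le_card _ k k.+1).
by rewrite mulrCA -mulrA [n%:R * _]mulrCA ler_wpM2l // binS_le.
Qed.

(** The mean of [nu] is nearly linear in c at first: by Bernoulli's inequality the
    greedy bound holds with [s^-1 = 1 - lam * c] as long as
    [k * lam * c <= 1 - lam], while tau is at most the number of edges. *)
Lemma gap_small k m (lam c1 : R) : (0 < k)%N -> 0 <= c1 -> 0 < lam ->
  k%:R * lam * c1 <= 1 - lam -> 1 < m%:R * lam -> gap k m c1.
Proof.
move=> k0 c10 lam_gt0 kl ml; have lam0 := ltW lam_gt0.
have k1 : 1 <= k%:R :> R by rewrite ler1n.
have lc1 : lam * c1 < 1.
  have : lam * c1 <= k%:R * (lam * c1) by rewrite ler_peMl ?mulr_ge0.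
  by rewrite mulrA; lra.
have H c : 0 <= c -> c <= c1 -> 1 <= (1 - lam * c) ^+ k * (1 + k%:R * c).
  move=> c0 cc1; have lc : lam * c <= lam * c1 by rewrite ler_wpM2l.
  have : 1 + k%:R * - (lam * c) <= (1 - lam * c) ^+ k by apply: bernoulli_ge; lra.
  have kc0 : 0 <= k%:R * c by rewrite mulr_ge0.
  move=> /(ler_wpM2r (addr_ge0 ler01 kc0)); apply: le_trans.
  have : k%:R * lam * c <= 1 - lam by apply: le_trans kl; rewrite ler_wpM2l ?mulr_ge0.
  move=> /(ler_wpM2l kc0); lra.
set r : R := k.+1%:R.
have r0 : 0 < r by rewrite ltr0n.
have rN0 : 1 + k%:R != 0 :> R by rewrite nat1r pnatr_eq0.
have [B B0 HB] := @nu_lower R k c1 k0 c10.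
pose e := m%:R * lam - 1; have e0 : 0 < e by rewrite subr_gt0.
exists (e / (2 * r)); first by rewrite divr_gt0 // mulr_gt0.
have [n0 Hn0] := nat_above (2 * m%:R * B / e); exists n0.+1 => n p n0n p01 npc.
have [p0 p1] := andP p01.
set c := n%:R * p in npc *; have c0 : 0 <= c by rewrite mulr_ge0.
have n_gt0 : 0 < n%:R :> R by rewrite ltr0n (leq_trans _ n0n).
have lc : 0 < 1 - lam * c.
  by rewrite subr_gt0 (le_lt_trans _ lc1) // ler_wpM2l.
have := HB n p (1 - lam * c)^-1 p01 npc; rewrite invr_gt0 => /(_ lc).
rewrite exprVn -[X in X <= 1 + _]div1r ler_pdivrMr ?exprn_gt0 // mulrC => /(_ (H c c0 npc)).
rewrite invrK -/(Enu k n p) -/r => HN.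
have HT := Etau_le_edges k n p01; rewrite -/c -/r in HT.
set N : R := 'C(n, k)%:R in HN HT *; have N0 : 0 <= N by [].
have Bn : m%:R * B * p <= e / 2 * c.
  have : 2 * m%:R * B <= e * n%:R.
    rewrite [leRHS]mulrC -ler_pdivrMr // (le_trans Hn0) // ler_nat; exact: ltnW.
  move=> /(ler_wpM2r p0); rewrite /c; lra.
have {}HN : N * (m%:R * (lam * c)) - N * (e / 2 * c) <= m%:R * (r * Enu k n p).
  apply: le_trans (ler_wpM2l (ler0n R m) HN).
  have := ler_wpM2l N0 Bn; move: (m%:R : R) => M; lra.
rewrite -(ler_pM2l r0) mulrBr.
have -> : r * (e / (2 * r) * c * N) = e / 2 * c * N.
  by field.
rewrite [r * (m%:R * _)]mulrCA.
have : N * (m%:R * (lam * c)) = N * c + N * (e * c) by rewrite /e; ring.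
move: HT HN; move: (m%:R * (r * _)) (r * Etau k n p) => X Y.
by move: (N * (m%:R * (lam * c))) => Z; lra.
Qed.

(** On the interval from [ca] to [cb], use the bound for nu at its left end and the
    bound for tau at its right end. *)
Lemma gap_step k m (s a ca cb : R) : (0 < k)%N -> gap k m ca -> 0 <= ca ->
  0 < s -> s ^+ k <= 1 + k%:R * ca -> tau_bound k cb a ->
  a * k.+1%:R < m%:R * (1 - s^-1) -> gap k m cb.
Proof.
move=> k0 [e1 e10 [n1 H1]] ca0 s0 sk tb lt_a; set r : R := k.+1%:R in lt_a *.
have r0 : 0 < r by rewrite ltr0n.
have rN0 : 1 + k%:R != 0 :> R by rewrite nat1r pnatr_eq0.
have [cb0|cb0] := ltP cb 0.
  exists 1 => //; exists 0%N => n p _ /andP[p0 _] npc.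
  by have := le_lt_trans npc cb0; rewrite ltNge mulr_ge0.
have [B B0 HB] := @nu_lower R k cb k0 cb0.
pose g := m%:R * (1 - s^-1) - a * r; have g0 : 0 < g by rewrite subr_gt0.
have [|n2 H2] := tb (g / (4 * r)); first by rewrite divr_gt0 // mulr_gt0.
have [|n3 H3] := @small_p cb (g / (4 * (m%:R * B + 1))).
  by rewrite divr_gt0 // mulr_gt0 // ltr_wpDl // mulr_ge0.
pose e2 := g / (2 * r * (cb + 1)).
have e20 : 0 < e2 by rewrite divr_gt0 // !mulr_gt0 // ltr_wpDl.
exists (Num.min e1 e2); first by rewrite lt_min e10.
exists (maxn n1 (maxn n2 n3)) => n p; rewrite !geq_max => /and3P[n1n n2n n3n] p01 npc.
have [p0 p1] := andP p01.
set c := n%:R * p in npc *; have c0 : 0 <= c by rewrite mulr_ge0.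
set N : R := 'C(n, k)%:R; have N0 : 0 <= N by [].
have [cca|/ltW cac] := leP c ca.
  apply: le_trans (H1 n p n1n p01 cca); rewrite -/N -/c ler_wpM2r // ler_wpM2r //.
  by rewrite ge_min lexx.
have HT := H2 n p n2n p01 npc; rewrite -/N in HT.
have HN := HB n p s p01 npc s0 _.
have {}HN : N * (1 - s^-1 - B * p) <= r * Enu k n p.
  by apply: HN; apply: (le_trans sk); rewrite lerD2l ler_wpM2l.
have Bp : (m%:R * B) * p <= g / 4.
  have mB : 0 <= m%:R * B by rewrite mulr_ge0.
  have := H3 n p n3n npc; rewrite ler_pdivlMr; last by rewrite mulr_gt0 // ltr_wpDl.
  by move=> h; lra.
apply: (@le_trans _ _ (e2 * c * N)).
  by rewrite ler_wpM2r // ler_wpM2r // ge_min lexx orbT.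
rewrite -(ler_pM2l r0) mulrBr [r * (m%:R * _)]mulrCA.
have -> : r * (e2 * c * N) = g / 2 * (c / (cb + 1)) * N.
  by rewrite /e2; field; rewrite rN0 andbT gt_eqF // ltr_wpDl.
have cb1 : c / (cb + 1) <= 1 by rewrite ler_pdivrMr ?ltr_wpDl // mul1r (le_trans npc) // lerDl.
have G1 : g / 2 * (c / (cb + 1)) * N <= g / 2 * N.
  by rewrite ler_wpM2r // ler_piMr // divr_ge0 // ltW.
apply: (le_trans G1).
have T1 : r * Etau k n p <= (a * r + g / 4) * N.
  apply: (le_trans (ler_wpM2l (ltW r0) HT)).
  by rewrite le_eqVlt; apply/orP; left; apply/eqP; field.
have N1 : N * (m%:R * (1 - s^-1)) - N * (g / 4) <= m%:R * (r * Enu k n p).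
  apply: le_trans (ler_wpM2l (ler0n R m) HN).
  by have := ler_wpM2l N0 Bp; move: (m%:R : R) (s^-1) => M i; lra.
have : N * (m%:R * (1 - s^-1)) = N * (a * r) + N * g by rewrite /g; ring.
move: T1 N1; move: (m%:R * (r * _)) (r * Etau k n p) => X Y.
by move: (N * (m%:R * (1 - s^-1))) => Z; lra.
Qed.

(** Beyond the last point of the grid the mean of [nu] can only grow with [p],
    and a family covering all the edges bounds [tau]. *)
Lemma gap_dense k m (s kap C : R) : (0 < k)%N -> 0 < C ->
  (forall n : nat, exists2 D, covers_all (n := n) k D & #|D|%:R <= kap * 'C(n, k)%:R) ->
  0 < s -> s ^+ k <= 1 + k%:R * C -> kap * k.+1%:R < m%:R * (1 - s^-1) ->
  exists2 eps : R, 0 < eps & exists n0 : nat, forall n p, (n0 <= n)%N -> 0 <= p <= 1 ->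
    C <= n%:R * p -> eps * 'C(n, k)%:R <= m%:R * Enu k n p - Etau k n p.
Proof.
move=> k0 C0 HD s0 sk lt_k; set r : R := k.+1%:R in lt_k *.
have r0 : 0 < r by rewrite ltr0n.
have rN0 : 1 + k%:R != 0 :> R by rewrite nat1r pnatr_eq0.
have [B B0 HB] := @nu_lower R k C k0 (ltW C0).
pose g := m%:R * (1 - s^-1) - kap * r; have g0 : 0 < g by rewrite subr_gt0.
have [|n3 H3] := @small_p C (g / (4 * (m%:R * B + 1))).
  by rewrite divr_gt0 // mulr_gt0 // ltr_wpDl // mulr_ge0.
exists (g / (2 * r)); first by rewrite divr_gt0 // mulr_gt0.
exists n3.+1 => n q n3n q01 Cq; have [q0 q1] := andP q01.
have n_gt0 : 0 < n%:R :> R by rewrite ltr0n (leq_trans _ n3n).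
pose p := C / n%:R.
have npC : n%:R * p = C by rewrite /p mulrC divfK // gt_eqF.
have p0 : 0 <= p by rewrite divr_ge0 // ltW.
have pq : p <= q by rewrite /p ler_pdivrMr // mulrC.
have p01 : 0 <= p <= 1 by rewrite p0 (le_trans pq).
set N : R := 'C(n, k)%:R; have N0 : 0 <= N by [].
have HN : N * (1 - s^-1 - B * p) <= r * Enu k n p.
  by apply: HB; rewrite ?npC.
have HE : Enu k n p <= Enu k n q.
  by apply: Ex_monotone => // e G _ _; rewrite ler_nat nu_mono // subsetUr.
have HT : Etau k n q <= kap * N.
  have [D DK Dn] := HD n; apply: le_trans Dn.
  rewrite -[leRHS](Ex_cst q (ksets 'I_n k.+1)); apply: ler_Ex => // G GK.
  by rewrite ler_nat tau_le_covers_all.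
have Bp : (m%:R * B) * p <= g / 4.
  have mB : 0 <= m%:R * B by rewrite mulr_ge0.
  have := H3 n p (ltnW n3n); rewrite npC lexx => /(_ isT).
  rewrite ler_pdivlMr; last by rewrite mulr_gt0 // ltr_wpDl.
  by move=> h; lra.
rewrite -(ler_pM2l r0) mulrBr [r * (m%:R * _)]mulrCA.
have -> : r * (g / (2 * r) * N) = g / 2 * N by field.
have T1 : r * Etau k n q <= (kap * r) * N.
  by apply: (le_trans (ler_wpM2l (ltW r0) HT)); rewrite mulrCA mulrA.
have N1 : N * (m%:R * (1 - s^-1)) - N * (g / 4) <= m%:R * (r * Enu k n q).
  apply: (@le_trans _ _ (m%:R * (r * Enu k n p))); last by rewrite !ler_wpM2l // ltW.
  apply: le_trans (ler_wpM2l (ler0n R m) HN).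
  by have := ler_wpM2l N0 Bp; move: (m%:R : R) (s^-1) => M i; lra.
have : N * (m%:R * (1 - s^-1)) = N * (kap * r) + N * g by rewrite /g; ring.
have : 0 <= g * N by rewrite mulr_ge0 // ltW.
move: T1 N1; move: (m%:R * (r * _)) (r * Etau k n q) => X Y.
by move: (N * (m%:R * (1 - s^-1))) => Z; lra.
Qed.

Lemma tau_bound_alloc k (kap c z : R) j : (0 < j)%N -> 0 < kap -> 0 <= c ->
  (forall n : nat, exists2 D, covers_all (n := n) k D & #|D|%:R <= kap * 'C(n, k)%:R) ->
  c / (k.+1%:R * kap) <= j%:R -> z <= (1 - c / (k.+1%:R * kap) / j%:R) ^+ j ->
  tau_bound k c (kap * (1 - z)).
Proof.
move=> j0 kap0 c0 HD cj zx del del0; set r : R := k.+1%:R in cj zx.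
have r0 : 0 < r by rewrite ltr0n.
have th0 : 0 <= (r * kap)^-1 by rewrite invr_ge0 ltW // mulr_gt0.
have [||n1 H1] := @pow_lower (r * kap)^-1 c j (del / kap) j0 th0 c0.
- by rewrite mulrC.
- by rewrite divr_gt0.
exists n1 => n p n1n p01 npc; have [D DK Dn] := HD n.
pose m := (Num.truncn ((r * kap)^-1 * n%:R)).+1.
have x0 : 0 <= (r * kap)^-1 * n%:R by rewrite mulr_ge0.
have [m1 m2] : (r * kap)^-1 * n%:R <= m%:R /\ m%:R <= (r * kap)^-1 * n%:R + 1.
  have /andP[l1 l2] := truncn_itv x0; split; first exact: ltW.
  by rewrite /m -natr1 lerD2r.
have nm : n%:R <= m%:R * (r * kap).
  by move: m1; rewrite mulrC ler_pdivrMr ?mulr_gt0.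
apply: (le_trans (tau_alloc p01 DK Dn nm)).
have := H1 n p m n1n p01 npc m2; rewrite [_^-1 * c]mulrC -/r.
move: zx; set x := (1 - _) ^+ j; move: ((1 - p) ^+ m) => y zx xy.
rewrite mulrAC ler_wpM2r // -subr_ge0.
have zy : z - del / kap <= y by lra.
have := ler_wpM2l (ltW kap0) zy; rewrite mulrBr [kap * (del / kap)]mulrC divfK ?gt_eqF //.
by lra.
Qed.

Lemma bin2R n : 2 * 'C(n, 2)%:R = n%:R * (n%:R - 1) :> R.
Proof.
elim: n => [|n IH]; first by rewrite mul0r mulr0.
rewrite binS bin1 natrD mulrDr IH -natr1; ring.
Qed.

Lemma bin3R n : 6 * 'C(n, 3)%:R = n%:R * (n%:R - 1) * (n%:R - 2) :> R.
Proof.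
elim: n => [|n IH]; first by rewrite !mul0r mulr0.
rewrite binS natrD mulrDr IH -natr1; have := bin2R n; move: ('C(n, 2)%:R : R) => b e.
by lra.
Qed.

Lemma half_cases n : exists2 h : R, (n./2)%:R = h /\ (h = 0 \/ 1 <= h) &
  (uphalf n)%:R = h /\ n%:R = 2 * h \/ (uphalf n)%:R = h + 1 /\ n%:R = 2 * h + 1.
Proof.
exists (n./2)%:R.
  by split=> //; case: (n./2) => [|h]; [left|right; rewrite ler1n].
have -> : n%:R = (odd n)%:R + 2 * (n./2)%:R :> R.
  by rewrite -[LHS](congr1 (fun i => i%:R) (odd_double_half n)) -mul2n natrD natrM.
rewrite uphalf_half natrD.
by case: (odd n); [right|left]; split; rewrite /= ?mulr1n ?add0r // addrC.
Qed.

Lemma card_halves2 n : ('C(n./2, 2) + 'C(uphalf n, 2))%:R <= 'C(n, 2)%:R / 2 :> R.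
Proof.
rewrite natrD; have := bin2R n; have := bin2R n./2; have := bin2R (uphalf n).
have [h [-> h0] [[-> ->]|[-> ->]]] := half_cases n; case: h0 => [->|h1] *; nra.
Qed.

Lemma card_halves3 n : ('C(n./2, 3) + 'C(uphalf n, 3))%:R <= n%:R * 'C(n, 2)%:R / 12 :> R.
Proof.
have e : 'C(n, 2)%:R = n%:R * (n%:R - 1) / 2 :> R by rewrite -bin2R mulrAC divff ?mul1r ?pnatr_eq0.
rewrite natrD e; have := bin3R n./2; have := bin3R (uphalf n).
have [h [-> h0] [[-> ->]|[-> ->]]] := half_cases n; case: h0 => [->|h1] *; nra.
Qed.

(** Put y = (1 - p) ^ uphalf n.  The numbers of monochromatic pairs and triples are
    at most [N / 2] and [n * N / 12]; the factor [11 / 10] on the latter absorbs the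
    difference of the halves in size.  Replacing y by a smaller number only
    increases the bound, because [n * p * y ^ 2 <= 1]. *)
Lemma tau_bound_halves (c z : R) j : (0 < j)%N -> 0 <= c -> c / 2 <= j%:R ->
  0 <= z -> z <= (1 - c / 2 / j%:R) ^+ j ->
  tau_bound 2 c ((1 - z) / 2 + 11 / 120 * c * z ^+ 3).
Proof.
move=> j0 c0 cj z0 zx del del0.
have [||n1 H1] := @pow_lower 2^-1 c j del j0 _ c0 _ del0; first by rewrite invr_ge0.
  by rewrite mulrC.
have [|n2 H2] := @small_p c (1 / 40); first by lra.
exists (maxn n1 n2) => n p; rewrite geq_max => /andP[n1n n2n] p01 npc.
have [p0 p1] := andP p01.
have ps := H2 n p n2n npc.
have q0 : 0 <= 1 - p by rewrite subr_ge0.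
have q1 : 1 - p <= 1 by rewrite gerBl.
have half_n : (uphalf n <= (n./2).+1)%N.
  by rewrite uphalf_half -add1n leq_add2r; case: (odd n).
have h2n : (n <= 2 * uphalf n)%N.
  by rewrite uphalf_half mulnDr -{1}[n]odd_double_half !mul2n leq_add2r; case: (odd n).
have n2h : (2 * n./2 <= n)%N by rewrite mul2n -[X in (_ <= X)%N]odd_double_half leq_addl.
have := H1 n p (uphalf n) n1n p01 npc; rewrite [_^-1 * c]mulrC => HY.
have {HY}zy : (1 - c / 2 / j%:R) ^+ j - del <= (1 - p) ^+ uphalf n.
  apply: HY; have : (uphalf n)%:R <= (n./2)%:R + 1 :> R by rewrite natr1 ler_nat.
  have : 2 * (n./2)%:R <= n%:R :> R by rewrite -natrM ler_nat.
  by lra.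
have cub : (1 - p) ^+ (3 * n./2) <= 11 / 10 * ((1 - p) ^+ uphalf n) ^+ 3.
  have : (1 - p) ^+ (3 * (n./2).+1) <= ((1 - p) ^+ uphalf n) ^+ 3.
    by rewrite -exprM mulnC ler_wiXn2l // leq_mul2r half_n.
  rewrite mulnS exprD.
  have q3 : 10 / 11 <= (1 - p) ^+ 3.
    by have := @bernoulli_ge R (- p) 3; lra.
  have Y0 : 0 <= (1 - p) ^+ (3 * n./2) by rewrite exprn_ge0.
  have := ler_wpM2r Y0 q3; lra.
have y01 : 0 <= (1 - p) ^+ uphalf n <= 1 by rewrite exprn_ge0 ?exprn_ile1.
have cy : n%:R * p * ((1 - p) ^+ uphalf n) ^+ 2 <= 1.
  have := @exprn_mul1D_le1 R p n p01.
  have e0 : 0 <= (1 - p) ^+ n by rewrite exprn_ge0.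
  have : ((1 - p) ^+ uphalf n) ^+ 2 <= (1 - p) ^+ n.
    by rewrite -exprM mulnC ler_wiXn2l.
  have np0 : 0 <= n%:R * p by rewrite mulr_ge0.
  by move=> /(ler_wpM2l np0); lra.
apply: (le_trans (@tau_halves R n p p01)).
have N0 : 0 <= 'C(n, 2)%:R :> R by [].
have A2 := card_halves2 n; have A3 := card_halves3 n.
move: zy cub y01 cy; set y := (1 - p) ^+ uphalf n; set Y := (1 - p) ^+ (3 * n./2).
set x := (1 - _) ^+ j in zx * => zy cub /andP[y0 y1] cy.
pose cn := n%:R * p; rewrite -/cn in cy npc.
have cn0 : 0 <= cn by rewrite mulr_ge0.
set N : R := 'C(n, 2)%:R in N0 A2 A3 *.
apply: (@le_trans _ _ (((1 - y) / 2 + 11 / 120 * cn * y ^+ 3) * N)).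
  have T1 : ('C(n./2, 2) + 'C(uphalf n, 2))%:R * (1 - y) <= N / 2 * (1 - y).
    by rewrite ler_wpM2r // subr_ge0.
  have T2 : ('C(n./2, 3) + 'C(uphalf n, 3))%:R * (p * Y) <=
      n%:R * N / 12 * (p * (11 / 10 * y ^+ 3)).
    rewrite ler_pM ?mulr_ge0 ?exprn_ge0 // ler_wpM2l //.
  apply: (le_trans (lerD T1 T2)).
  by rewrite le_eqVlt; apply/orP; left; apply/eqP; rewrite /cn; field.
rewrite ler_wpM2r //.
pose w := Num.max 0 (z - del).
have w0 : 0 <= w by rewrite le_max lexx.
have wy : w <= y by rewrite ge_max y0 /=; lra.
apply: (@le_trans _ _ ((1 - w) / 2 + 11 / 120 * cn * w ^+ 3)).
  have h2 : cn * (w * w) <= 1.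
    by apply: le_trans cy; rewrite expr2 ler_wpM2l // ler_pM.
  have h3 : cn * (y * w) <= 1.
    by apply: le_trans cy; rewrite expr2 ler_wpM2l // ler_pM.
  have yw : 0 <= y - w by rewrite subr_ge0.
  rewrite expr2 in cy.
  have h4 : 0 <= (y - w) * (3 - cn * (y * y + y * w + w * w)).
    by rewrite mulr_ge0 //; lra.
  rewrite -subr_ge0.
  have -> : (1 - w) / 2 + 11 / 120 * cn * w ^+ 3 - ((1 - y) / 2 + 11 / 120 * cn * y ^+ 3) =
     11 / 120 * ((y - w) * (3 - cn * (y * y + y * w + w * w))) + 9 / 40 * (y - w) by field.
  by lra.
apply: (@le_trans _ _ ((1 - w) / 2 + 11 / 120 * c * w ^+ 3)).
  by rewrite lerD2l ler_wpM2r ?exprn_ge0 // ler_wpM2l // divr_ge0.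
have wz : w <= z by rewrite ge_max z0 /=; lra.
have : c * w ^+ 3 <= c * z ^+ 3 by rewrite ler_wpM2l // lerXn2r ?nnegrE.
have : z - del <= w by rewrite le_max lexx orbT.
by lra.
Qed.

End Numerics.

(** * The numerical comparison *)

Section Grid.
Variable R : realType.

(** The mean degree at which the greedy matching leaves a fraction [1 / s] of
    the k-sets uncovered. *)
Definition mean_degree k (s : R) : R := (s ^+ k - 1) / k%:R.

Lemma mean_degreeK k s : (0 < k)%N -> s ^+ k <= 1 + k%:R * mean_degree k s.
Proof. by move=> k0; rewrite /mean_degree mulrC divfK ?pnatr_eq0 -?lt0n // addrCA subrr addr0. Qed.

Lemma turan3_cover_real n :
  exists2 D, covers_all (n := n) 3 D & #|D|%:R <= 4 / 9 * 'C(n, 3)%:R :> R.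
Proof.
have [D DK Dn] := turan3_exists n; exists D => //.
by move: Dn; rewrite -(ler_nat R) !natrM; lra.
Qed.

Lemma giraud_cover_real n :
  exists2 D, covers_all (n := n) 4 D & #|D|%:R <= 5 / 16 * 'C(n, 4)%:R :> R.
Proof.
have [D DK Dn] := giraud_exists n; exists D => //.
by move: Dn; rewrite -(ler_nat R) !natrM; lra.
Qed.

Lemma halves_cover_real n :
  exists2 D, covers_all (n := n) 2 D & #|D|%:R <= 1 / 2 * 'C(n, 2)%:R :> R.
Proof.
exists (mono2 n); first exact: mono2_cover.
have := card_halves2 R n; have : #|mono2 n|%:R <= ('C(n./2, 2) + 'C(uphalf n, 2))%:R :> R.
  by rewrite ler_nat card_mono.
by lra.
Qed.

(** In this and the next two lemmas the interval runs from [mean_degree k s] to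
    [mean_degree k t], and [z] is a lower bound for the exponential at
    its right end. *)
Lemma gap_step3 (s t z : R) : gap 2 2 (mean_degree 2 s) -> 1 <= s -> 1 <= t -> t <= 5 -> 0 <= z ->
  z <= (1 - mean_degree 2 t / 2 / 128%:R) ^+ 128 ->
  ((1 - z) / 2 + 11 / 120 * mean_degree 2 t * z ^+ 3) * 3 < 2 * (1 - s^-1) ->
  gap 2 2 (mean_degree 2 t).
Proof.
move=> g s1 t1 t5 z0.
have ct0 : 0 <= mean_degree 2 t by rewrite /mean_degree; nra.
have ct1 : mean_degree 2 t <= 12 by rewrite /mean_degree; nra.
have cs0 : 0 <= mean_degree 2 s by rewrite /mean_degree; nra.
have s0 : 0 < s by lra.
have cj : mean_degree 2 t / 2 <= 128%:R by lra.
move=> zx lt_s.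
exact: (gap_step (k := 2) isT g cs0 s0 (mean_degreeK (k := 2) s isT)
  (tau_bound_halves (j := 128) isT ct0 cj z0 zx) lt_s).
Qed.

Lemma gap_step4 (s t z : R) : gap 3 3 (mean_degree 3 s) -> 1 <= s -> 1 <= t -> t <= 3 ->
  z <= (1 - mean_degree 3 t / (4 * (4 / 9)) / 32%:R) ^+ 32 ->
  (4 / 9 * (1 - z)) * 4 < 3 * (1 - s^-1) -> gap 3 3 (mean_degree 3 t).
Proof.
move=> g s1 t1 t5.
have t3 : 1 <= t ^+ 3 <= 27.
  apply/andP; split; first exact: exprn_ege1.
  by rewrite (_ : 27 = 3 ^+ 3) ?lerXn2r ?nnegrE //; [lra|ring].
have ct0 : 0 <= mean_degree 3 t by rewrite /mean_degree; lra.
have ct1 : mean_degree 3 t <= 9 by rewrite /mean_degree; lra.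
have cs0 : 0 <= mean_degree 3 s by rewrite /mean_degree divr_ge0 // subr_ge0 exprn_ege1.
have s0 : 0 < s by lra.
have k0 : 0 < 4 / 9 :> R by lra.
have cj : mean_degree 3 t / (4 * (4 / 9)) <= 32%:R by lra.
move=> zx lt_s.
exact: (gap_step (k := 3) isT g cs0 s0 (mean_degreeK (k := 3) s isT)
  (tau_bound_alloc (j := 32) isT k0 ct0 turan3_cover_real cj zx) lt_s).
Qed.

Lemma gap_step5 (s t z : R) : gap 4 3 (mean_degree 4 s) -> 1 <= s -> 1 <= t -> t <= 3 ->
  z <= (1 - mean_degree 4 t / (5 * (5 / 16)) / 64%:R) ^+ 64 ->
  (5 / 16 * (1 - z)) * 5 < 3 * (1 - s^-1) -> gap 4 3 (mean_degree 4 t).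
Proof.
move=> g s1 t1 t5.
have t3 : 1 <= t ^+ 4 <= 81.
  apply/andP; split; first exact: exprn_ege1.
  by rewrite (_ : 81 = 3 ^+ 4) ?lerXn2r ?nnegrE //; [lra|ring].
have ct0 : 0 <= mean_degree 4 t by rewrite /mean_degree; lra.
have ct1 : mean_degree 4 t <= 20 by rewrite /mean_degree; lra.
have cs0 : 0 <= mean_degree 4 s by rewrite /mean_degree divr_ge0 // subr_ge0 exprn_ege1.
have s0 : 0 < s by lra.
have k0 : 0 < 5 / 16 :> R by lra.
have cj : mean_degree 4 t / (5 * (5 / 16)) <= 64%:R by lra.
move=> zx lt_s.
exact: (gap_step (k := 4) isT g cs0 s0 (mean_degreeK (k := 4) s isT)
  (tau_bound_alloc (j := 64) isT k0 ct0 giraud_cover_real cj zx) lt_s).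
Qed.

(** Each grid point is nearly the furthest that [gap_step3] reaches from its
    predecessor.  The margin is tightest near c = 5, and the last point is past
    the value of c where the greedy matching beats the cover by all the pairs
    inside the halves. *)
Lemma gap3 : gap 2 2 (mean_degree 2 (113 / 25 : R)).
Proof.
have g : gap 2 2 (mean_degree 2 (33 / 25 : R)).
  by apply: (gap_small (lam := 11 / 20)); rewrite /mean_degree //; lra.
have {}g : gap 2 2 (mean_degree 2 (37 / 25 : R)).
  by apply: (gap_step3 (z := 742 / 1000) g); rewrite /mean_degree; lra.
have {}g : gap 2 2 (mean_degree 2 (43 / 25 : R)).
  by apply: (gap_step3 (z := 612 / 1000) g); rewrite /mean_degree; lra.
have {}g : gap 2 2 (mean_degree 2 (50 / 25 : R)).
  by apply: (gap_step3 (z := 471 / 1000) g); rewrite /mean_degree; lra.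
have {}g : gap 2 2 (mean_degree 2 (56 / 25 : R)).
  by apply: (gap_step3 (z := 364 / 1000) g); rewrite /mean_degree; lra.
have {}g : gap 2 2 (mean_degree 2 (62 / 25 : R)).
  by apply: (gap_step3 (z := 274 / 1000) g); rewrite /mean_degree; lra.
have {}g : gap 2 2 (mean_degree 2 (67 / 25 : R)).
  by apply: (gap_step3 (z := 211 / 1000) g); rewrite /mean_degree; lra.
have {}g : gap 2 2 (mean_degree 2 (71 / 25 : R)).
  by apply: (gap_step3 (z := 168 / 1000) g); rewrite /mean_degree; lra.
have {}g : gap 2 2 (mean_degree 2 (74 / 25 : R)).
  by apply: (gap_step3 (z := 141 / 1000) g); rewrite /mean_degree; lra.
have {}g : gap 2 2 (mean_degree 2 (76 / 25 : R)).
  by apply: (gap_step3 (z := 125 / 1000) g); rewrite /mean_degree; lra.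
have {}g : gap 2 2 (mean_degree 2 (78 / 25 : R)).
  by apply: (gap_step3 (z := 110 / 1000) g); rewrite /mean_degree; lra.
have {}g : gap 2 2 (mean_degree 2 (80 / 25 : R)).
  by apply: (gap_step3 (z := 97 / 1000) g); rewrite /mean_degree; lra.
have {}g : gap 2 2 (mean_degree 2 (82 / 25 : R)).
  by apply: (gap_step3 (z := 85 / 1000) g); rewrite /mean_degree; lra.
have {}g : gap 2 2 (mean_degree 2 (84 / 25 : R)).
  by apply: (gap_step3 (z := 74 / 1000) g); rewrite /mean_degree; lra.
have {}g : gap 2 2 (mean_degree 2 (86 / 25 : R)).
  by apply: (gap_step3 (z := 64 / 1000) g); rewrite /mean_degree; lra.
have {}g : gap 2 2 (mean_degree 2 (88 / 25 : R)).
  by apply: (gap_step3 (z := 56 / 1000) g); rewrite /mean_degree; lra.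
have {}g : gap 2 2 (mean_degree 2 (90 / 25 : R)).
  by apply: (gap_step3 (z := 48 / 1000) g); rewrite /mean_degree; lra.
have {}g : gap 2 2 (mean_degree 2 (93 / 25 : R)).
  by apply: (gap_step3 (z := 38 / 1000) g); rewrite /mean_degree; lra.
have {}g : gap 2 2 (mean_degree 2 (98 / 25 : R)).
  by apply: (gap_step3 (z := 26 / 1000) g); rewrite /mean_degree; lra.
have {}g : gap 2 2 (mean_degree 2 (113 / 25 : R)).
  by apply: (gap_step3 (z := 7 / 1000) g); rewrite /mean_degree; lra.
by [].
Qed.

Lemma gap4 : gap 3 3 (mean_degree 3 (27 / 10 : R)).
Proof.
have g : gap 3 3 (mean_degree 3 (13 / 10 : R)).
  by apply: (gap_small (lam := 2 / 5)); rewrite /mean_degree //; lra.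
have {}g : gap 3 3 (mean_degree 3 (15 / 10 : R)).
  by apply: (gap_step4 (z := 638 / 1000) g); rewrite /mean_degree; lra.
have {}g : gap 3 3 (mean_degree 3 (17 / 10 : R)).
  by apply: (gap_step4 (z := 476 / 1000) g); rewrite /mean_degree; lra.
have {}g : gap 3 3 (mean_degree 3 (19 / 10 : R)).
  by apply: (gap_step4 (z := 326 / 1000) g); rewrite /mean_degree; lra.
have {}g : gap 3 3 (mean_degree 3 (21 / 10 : R)).
  by apply: (gap_step4 (z := 204 / 1000) g); rewrite /mean_degree; lra.
have {}g : gap 3 3 (mean_degree 3 (22 / 10 : R)).
  by apply: (gap_step4 (z := 155 / 1000) g); rewrite /mean_degree; lra.
have {}g : gap 3 3 (mean_degree 3 (24 / 10 : R)).
  by apply: (gap_step4 (z := 82 / 1000) g); rewrite /mean_degree; lra.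
have {}g : gap 3 3 (mean_degree 3 (27 / 10 : R)).
  by apply: (gap_step4 (z := 24 / 1000) g); rewrite /mean_degree; lra.
by [].
Qed.

Lemma gap5 : gap 4 3 (mean_degree 4 (45 / 20 : R)).
Proof.
have g : gap 4 3 (mean_degree 4 (25 / 20 : R)).
  by apply: (gap_small (lam := 2 / 5)); rewrite /mean_degree //; lra.
have {}g : gap 4 3 (mean_degree 4 (28 / 20 : R)).
  by apply: (gap_step5 (z := 633 / 1000) g); rewrite /mean_degree; lra.
have {}g : gap 4 3 (mean_degree 4 (31 / 20 : R)).
  by apply: (gap_step5 (z := 463 / 1000) g); rewrite /mean_degree; lra.
have {}g : gap 4 3 (mean_degree 4 (33 / 20 : R)).
  by apply: (gap_step5 (z := 355 / 1000) g); rewrite /mean_degree; lra.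
have {}g : gap 4 3 (mean_degree 4 (35 / 20 : R)).
  by apply: (gap_step5 (z := 257 / 1000) g); rewrite /mean_degree; lra.
have {}g : gap 4 3 (mean_degree 4 (36 / 20 : R)).
  by apply: (gap_step5 (z := 214 / 1000) g); rewrite /mean_degree; lra.
have {}g : gap 4 3 (mean_degree 4 (37 / 20 : R)).
  by apply: (gap_step5 (z := 175 / 1000) g); rewrite /mean_degree; lra.
have {}g : gap 4 3 (mean_degree 4 (38 / 20 : R)).
  by apply: (gap_step5 (z := 141 / 1000) g); rewrite /mean_degree; lra.
have {}g : gap 4 3 (mean_degree 4 (39 / 20 : R)).
  by apply: (gap_step5 (z := 111 / 1000) g); rewrite /mean_degree; lra.
have {}g : gap 4 3 (mean_degree 4 (41 / 20 : R)).
  by apply: (gap_step5 (z := 65 / 1000) g); rewrite /mean_degree; lra.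
have {}g : gap 4 3 (mean_degree 4 (45 / 20 : R)).
  by apply: (gap_step5 (z := 17 / 1000) g); rewrite /mean_degree; lra.
by [].
Qed.

End Grid.

(** * From the means to high probability *)

Section Tail.
Variable R : realType.
Implicit Types (p C : R) (n k m : nat).

Lemma bin_gt_sub n k : (0 < k)%N -> (k <= n)%N -> (n - k < 'C(n, k))%N.
Proof.
case: k => // k _; elim: n k => [//|n IH] k; rewrite ltnS => kn.
rewrite binS subSS; move: kn; rewrite leq_eqVlt => /orP[/eqP ->|kn].
  by rewrite subnn binn addn1.
rewrite -(subnSK kn) -addn1 leq_add ?IH // bin_gt0; exact: ltnW.
Qed.

Definition slack k m n (G : {set {set 'I_n}}) : R := m%:R * (nu k G)%:R - (tau k G)%:R.

Lemma slack_lipschitz k m n e (G : {set {set 'I_n}}) :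
  e \in ksets 'I_n k.+1 -> G \subset ksets 'I_n k.+1 ->
  `|slack k m (e |: G) - slack k m G| <= m%:R + 1.
Proof.
move=> eK GK; have eG : is_rgraph k.+1 (e |: G) by rewrite /is_rgraph subUset sub1set eK.
have s : G \subset e |: G by exact: subsetUr.
have n1 : (nu k G)%:R <= (nu k (e |: G))%:R :> R by rewrite ler_nat nu_mono.
have n2 : (nu k (e |: G))%:R <= (nu k G)%:R + 1 :> R by rewrite natr1 ler_nat nu_setU1.
have t1 : (tau k G)%:R <= (tau k (e |: G))%:R :> R by rewrite ler_nat (tau_mono (leqnSn k)).
have t2 : (tau k (e |: G))%:R <= (tau k G)%:R + 1 :> R.
  by rewrite natr1 ler_nat (tau_setU1 (leqnSn k)).
have m0 : 0 <= m%:R :> R by [].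
move: n1 n2 t1 t2 m0; rewrite /slack ler_norml.
move: (m%:R : R) (_%:R : R) (_%:R : R) (_%:R : R) (_%:R : R) => a x y z w *.
by apply/andP; split; nra.
Qed.

Lemma Ex_slack k m n p :
  Ex p (ksets 'I_n k.+1) (slack k m (n := n)) = m%:R * Enu k n p - Etau k n p.
Proof. by rewrite ExB ExZ. Qed.

Lemma slack_tail k m n p (mu : R) : 0 <= p <= 1 -> 0 < mu ->
  mu <= m%:R * Enu k n p - Etau k n p ->
  Ex p (ksets 'I_n k.+1) (fun G => (slack k m G < 0)%R%:R) <=
    (m%:R + 1) ^+ 2 * (p * 'C(n, k.+1)%:R) / mu ^+ 2.
Proof.
move=> p01 mu0 H; have [p0 p1] := andP p01.
have E0 : mu <= Ex p (ksets 'I_n k.+1) (slack k m (n := n)) by rewrite Ex_slack.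
apply: (le_trans (Chebyshev p01 (lt_le_trans mu0 E0) (@slack_lipschitz k m n))).
have c0 : 0 <= (m%:R + 1) ^+ 2 * (p * 'C(n, k.+1)%:R) :> R.
  by apply: mulr_ge0; [exact: sqr_ge0|exact: mulr_ge0].
rewrite card_ksets ler_wpM2l //.
rewrite lef_pV2 ?posrE ?exprn_gt0 //; last exact: lt_le_trans mu0 E0.
by rewrite lerXn2r ?nnegrE // (le_trans (ltW mu0)).
Qed.

(** When few edges are expected, typically no two of them share k vertices, and
    then all the edges form a matching. *)
Lemma slack_sparse k m n p : (0 < m)%N -> 0 <= p <= 1 ->
  Ex p (ksets 'I_n k.+1) (fun G => (slack k m G < 0)%R%:R) <=
    'C(n, k.+1)%:R * k.+1%:R * n%:R * p ^+ 2.
Proof.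
move=> m0 p01; have [p0 p1] := andP p01; set K := ksets 'I_n k.+1.
pose near f := [set g in K | (g != f) && (k <= #|f :&: g|)%N].
have near_card f : f \in K -> (#|near f| <= k.+1 * n)%N.
  move=> fK; rewrite -(faces_uniform fK) -sum_nat_const.
  apply: (@leq_trans (\sum_(S in faces k f) #|[set g in K | S \in faces k g]|)); last first.
    by apply: leq_sum => S _; apply: card_through; [exact: label_proper|exact: label_lt].
  rewrite (eq_bigr (fun S => \sum_(g in K) (S \in faces k g))%N) => [|S _]; last first.
    by rewrite sum_nat_in.
  rewrite exchange_big /= -sum1_card.
  rewrite (eq_bigl (fun g => (g \in K) && ((g != f) && (k <= #|f :&: g|)%N))) => [|g]; last first.
    by rewrite inE.
  rewrite big_mkcondr /=; apply: leq_sum => g gK; case: ifP => // /andP[_ /ksubset_exists[S]].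
  rewrite subsetI => /andP[Sf Sg] Sk.
  by rewrite (bigD1 S) /= !inE ?Sf ?Sg ?Sk ?eqxx.
have bad (G : {set {set 'I_n}}) : G \subset K ->
    ((slack k m G < 0)%R <= \sum_(f in K) \sum_(g in near f)
     ((f \in G) && (g \in G)))%N.
  move=> GK; case: (boolP (slack k m G < 0)) => // neg.
  have [/exists_inP[f fG /exists_inP[g gG fg]]|none] :=
      boolP [exists f in G, exists g in G, g \in near f].
    rewrite (bigD1 f) ?(subsetP GK) //= (bigD1 g) //= fG gG.
    by rewrite -!addnA leq_addr.
  move: neg; rewrite ltNge => /negP[]; rewrite subr_ge0 -natrM ler_nat.
  have [_ H] := nuP k G.
  apply: (@leq_trans #|G|); first by apply: (@tau_le_card _ k k.+1).
  apply: (@leq_trans (nu k G)); last by rewrite leq_pmull.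
  apply: H; rewrite /is_matching subxx /=; apply/forall_inP => f fG; apply/forall_inP => g gG.
  apply/implyP => fg; rewrite ltnNge; apply: contra none => kfg.
  apply/exists_inP; exists f => //; apply/exists_inP; exists g => //.
  by rewrite inE (subsetP GK) //= eq_sym fg.
apply: (@le_trans _ _ (\sum_(f in K) \sum_(g in near f) p ^+ 2)).
  rewrite (_ : \sum_(f in K) _ =
     Ex p K (fun G => (\sum_(f in K) \sum_(g in near f) ((f \in G) && (g \in G)))%N%:R)).
    by apply: ler_Ex => // G GK; rewrite ler_nat bad.
  transitivity (Ex p K (fun G => \sum_(f in K) \sum_(g in near f)
      (f \in G)%:R * ((g \in G)%:R * 1))); last first.
    apply: eq_Ex => G _; rewrite natr_sum; apply: eq_bigr => f _.
    by rewrite natr_sum; apply: eq_bigr => g _; rewrite mulr1 -natrM mulnb.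
  rewrite Ex_sum; apply: eq_bigr => f fK; rewrite Ex_sum; apply: eq_bigr => g.
  rewrite inE => /and3P[gK gf _].
  rewrite Ex_mem // ?Ex_mem // ?Ex_cst ?expr2 ?mulr1 // => G.
  by rewrite !inE (negbTE gf).
rewrite -card_ksets -/K -!mulrA mulr_natl -sumr_const; apply: ler_sum => f fK.
rewrite sumr_const -[leLHS]mulr_natl [leRHS]mulrA ler_wpM2r ?sqr_ge0 //.
by rewrite -natrM ler_nat near_card.
Qed.

(** Three ranges of [p].  For [n * p >= C] and when the expected number of edges is
    at least [M], Chebyshev's inequality applies; otherwise [slack_sparse] does. *)
Lemma slack_whp k m C (eta : R) : (2 <= k)%N -> (0 < m)%N -> 0 < C -> gap k m C ->
  (exists2 eps : R, 0 < eps & exists n0 : nat, forall n p, (n0 <= n)%N -> 0 <= p <= 1 ->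
    C <= n%:R * p -> eps * 'C(n, k)%:R <= m%:R * Enu k n p - Etau k n p) ->
  0 < eta -> exists n0 : nat, forall n p, (n0 <= n)%N -> 0 <= p <= 1 ->
    Ex p (ksets 'I_n k.+1) (fun G => (slack k m G < 0)%R%:R) <= eta.
Proof.
move=> k2 m0 C0 [e1 e10 [n1 H1]] [e2 e20 [n2 H2]] eta0.
pose l : R := (m%:R + 1) ^+ 2.
have l0 : 0 < l by rewrite exprn_gt0 // ltr_wpDl.
have k0 : (0 < k)%N by exact: leq_trans k2.
pose r : R := k.+1%:R; have r0 : 0 < r by rewrite ltr0n.
have [n3 H3] := nat_above (l * k%:R / (e2 ^+ 2 * eta)).
pose M := l / (e1 ^+ 2 * eta).
have M0 : 0 < M by rewrite divr_gt0 // mulr_gt0 // exprn_gt0.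
have [n4 H4] := nat_above (M ^+ 2 * (r * r) / eta).
exists (k.+1 + n1 + n2 + n3 + n4).+1%N => n p nn p01; have [p0 p1] := andP p01.
have [n1n n2n n3n n4n kn] : [/\ (n1 <= n)%N, (n2 <= n)%N, (n3 <= n.-1 - k.-1)%N,
    (n4 <= n.-1 - k)%N & (k < n)%N].
  by move: nn; clear; split; lia.
have n_gt0 : 0 < n%:R :> R by rewrite ltr0n (leq_trans _ kn).
set N : R := 'C(n, k)%:R; set L : R := 'C(n, k.+1)%:R.
have LN : r * L <= n%:R * N by exact: binS_le.
have N0 : 0 < N by rewrite ltr0n bin_gt0 ltnW.
have L0 : 0 < L by rewrite ltr0n bin_gt0.
have r1 : 1 <= r by rewrite ler1n.
have [Cnp|npC] := leP C (n%:R * p).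
  have HE := H2 n p n2n p01 Cnp; rewrite -/N in HE.
  have eN : 0 < e2 * N by rewrite mulr_gt0.
  apply: (le_trans (slack_tail p01 eN HE)); rewrite -/l -/L.
  rewrite ler_pdivrMr ?exprn_gt0 // exprMn.
  have A1 : p * L <= n%:R * N.
    by rewrite (le_trans _ LN) // ler_pM // ?(le_trans p1) // ltW.
  have A2 : n%:R * n3%:R <= k%:R * N.
    have k1 : (0 < k.-1)%N by rewrite -ltnS prednK.
    rewrite -!natrM ler_nat -{1}(prednK k0) -{2}(prednK k0) -[n in 'C(n, _)](ltn_predK kn).
    rewrite -mul_bin_diag (ltn_predK kn) leq_mul2l; apply/orP; right.
    apply: (leq_trans n3n); apply: ltnW; apply: bin_gt_sub k1 _.
    by rewrite -ltnS (ltn_predK kn) (leq_ltn_trans (leq_pred k) kn).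
  have A3 : l * k%:R <= e2 ^+ 2 * eta * n3%:R.
    by rewrite [leRHS]mulrC -ler_pdivrMr // mulr_gt0 ?exprn_gt0.
  have : l * (p * L) <= l * (n%:R * N) by rewrite ler_wpM2l // ltW.
  move=> /le_trans; apply.
  have B1 : l * k%:R * N <= e2 ^+ 2 * eta * n3%:R * N by rewrite ler_wpM2r // ltW.
  have B2 : l * (n%:R * N) * n3%:R <= eta * (e2 ^+ 2 * N ^+ 2) * n3%:R.
    have : l * N * (n%:R * n3%:R) <= l * N * (k%:R * N) by rewrite ler_wpM2l // mulr_ge0 // ltW.
    have : l * k%:R * N * N <= e2 ^+ 2 * eta * n3%:R * N * N by rewrite ler_wpM2r // ltW.
    by rewrite [N ^+ 2]expr2; lra.
  have n3_gt0 : 0 < n3%:R :> R.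
    apply: lt_le_trans H3; apply: divr_gt0; first by rewrite mulr_gt0 // ltr0n.
    by rewrite mulr_gt0 // exprn_gt0.
  by move: B2; rewrite ler_pM2r.
have HE := H1 n p n1n p01 (ltW npC); rewrite -/N in HE.
set mu := p * L.
have muN : mu <= n%:R * p * N.
  apply: (@le_trans _ _ (p * (r * L))); first by rewrite ler_wpM2l // ler_peMl // ltW.
  by rewrite mulrAC [leRHS]mulrC ler_wpM2l.
have [Mmu|muM] := leP M mu.
  have mu0 : 0 < mu by exact: lt_le_trans Mmu.
  have emu : 0 < e1 * mu by rewrite mulr_gt0.
  have HE' : e1 * mu <= m%:R * Enu k n p - Etau k n p.
    by apply: le_trans HE; rewrite -mulrA ler_wpM2l // ltW.
  apply: (le_trans (slack_tail p01 emu HE')); rewrite -/l -/L -/mu.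
  rewrite ler_pdivrMr ?exprn_gt0 // exprMn.
  move: Mmu; rewrite /M ler_pdivrMr ?mulr_gt0 ?exprn_gt0 // => /(ler_wpM2r (ltW mu0)).
  by rewrite [mu ^+ 2]expr2; lra.
apply: (le_trans (slack_sparse k n m0 p01)); rewrite -/L -/r.
have A1 : n%:R * n4%:R <= r * L.
  rewrite -!natrM ler_nat -[n in 'C(n, _)](ltn_predK kn).
  rewrite -mul_bin_diag (ltn_predK kn) leq_mul2l; apply/orP; right.
  apply: (leq_trans n4n); apply: ltnW; apply: bin_gt_sub k0 _.
  by rewrite -ltnS (ltn_predK kn).
have mu0 : 0 <= mu by rewrite mulr_ge0 // ltW.
have A2 : mu ^+ 2 <= M ^+ 2 by rewrite lerXn2r ?nnegrE // ltW.
have A3 : M ^+ 2 * (r * r) <= n4%:R * eta by rewrite -ler_pdivrMr.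
have n4_gt0 : 0 < n4%:R :> R.
  apply: lt_le_trans H4; apply: divr_gt0 => //.
  by rewrite mulr_gt0 ?exprn_gt0 // mulr_gt0.
rewrite -(ler_pM2r n4_gt0) -(ler_pM2r L0).
have B1 : r * mu ^+ 2 * (n%:R * n4%:R) <= r * mu ^+ 2 * (r * L).
  by rewrite ler_wpM2l // mulr_ge0 ?sqr_ge0 // ltW.
have B2 : r * r * L * mu ^+ 2 <= r * r * L * M ^+ 2.
  by rewrite ler_wpM2l // !mulr_ge0 // ltW.
have B3 : M ^+ 2 * (r * r) * L <= n4%:R * eta * L by rewrite ler_wpM2r // ltW.
have -> : L * r * n%:R * p ^+ 2 * n4%:R * L = r * mu ^+ 2 * (n%:R * n4%:R) by rewrite /mu; ring.
by lra.
Qed.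

End Tail.

Lemma rgraph_prob_slack (R : realType) (k m n : nat) (p : R) : 0 <= p <= 1 ->
  rgraph_prob k.+1 p (fun G : {set {set 'I_n}} => (tau k G <= m * nu k G)%N) =
  1 - Ex p (ksets 'I_n k.+1) (fun G => (slack R k m G < 0)%R%:R).
Proof.
move=> p01; rewrite -[X in X - _](Ex_cst p (ksets 'I_n k.+1)) -ExB.
rewrite /rgraph_prob big_mkcondr /=; apply: eq_bigr => G _.
rewrite /slack subr_lt0 -natrM ltr_nat ltnNge.
by case: (tau k G <= _)%N; rewrite /= ?subr0 ?subrr ?mulr1 ?mulr0.
Qed.

Theorem theorem1p5 (R : realType) (r : nat) (p : nat -> R)
    (hr : r \in [:: 3%N; 4%N; 5%N]) (hp : forall n : nat, 0 <= p n <= 1) :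
  ((fun n : nat =>
      rgraph_prob r (p n) (fun G : {set {set 'I_n}} =>
        (tau r.-1 G <= uphalf r.+1 * nu r.-1 G)%N)) @ \oo --> (1 : R))%classic.
Proof.
suff [k [rk whp]] : exists k, r = k.+1 /\ forall eta : R, 0 < eta ->
    exists n0 : nat, forall n p, (n0 <= n)%N -> 0 <= p <= 1 ->
      Ex p (ksets 'I_n k.+1) (fun G => (slack R k (uphalf k.+2) G < 0)%R%:R) <= eta.
  subst r; apply/cvgrPdist_le => eta eta0; have [n0 H] := whp eta eta0.
  exists n0 => // n /= n0n; rewrite rgraph_prob_slack // opprB addrCA subrr addr0.
  by rewrite ger0_norm ?H // Ex_ge0.
move: hr; rewrite !inE => /or3P[] /eqP ->; [exists 2%N|exists 3%N|exists 4%N]; split=> // eta eta0.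
- have C0 : 0 < mean_degree 2 (113 / 25 : R) by rewrite /mean_degree; lra.
  apply: (slack_whp (k := 2) (m := 2) isT isT C0 (gap3 R) _ eta0).
  apply: (gap_dense (k := 2) (s := 113 / 25) isT C0 (@halves_cover_real R)); try lra.
  exact: (mean_degreeK (k := 2)).
- have C0 : 0 < mean_degree 3 (27 / 10 : R) by rewrite /mean_degree; lra.
  apply: (slack_whp (k := 3) (m := 3) isT isT C0 (gap4 R) _ eta0).
  apply: (gap_dense (k := 3) (s := 27 / 10) isT C0 (@turan3_cover_real R)); try lra.
  exact: (mean_degreeK (k := 3)).
- have C0 : 0 < mean_degree 4 (45 / 20 : R) by rewrite /mean_degree; lra.
  apply: (slack_whp (k := 4) (m := 3) isT isT C0 (gap5 R) _ eta0).
  apply: (gap_dense (k := 4) (s := 45 / 20) isT C0 (@giraud_cover_real R)); try lra.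
  exact: (mean_degreeK (k := 4)).
Qed.
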